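(* Let $n\ge 2$, $\gamma\in\{0,1\}$, $0<\alpha<1$. Let $C_{i,k}>0$ ($0\le i\le n$, $0\le k\le n$, $i+k\le n$) be fixed positive numbers (weights). Let $f_1,\dots,f_{n-1}>0$ and $\sigma_1,\dots,\sigma_{n-1}>0$ be arbitrary (unknown) parameters, and put $f_n=1$, $\sigma_n=0$. Randomness: let $\boldsymbol{\zeta}_{i,k}$ ($0\le i\le n-k$, $1\le k\le n-1$) and $\boldsymbol{\zeta}_{i,n-i+1}$ ($1\le i\le n$) be i.i.d. standard normal random variables; write $\boldsymbol{\mathcal R}=\{\boldsymbol\zeta_{i,k}: 0\le i\le n-k,\ 1\le k\le n-1\}$ (the residues of the observed triangle). Define the observed factors $\boldsymbol F_{i,k}=f_k+\sigma_k C_{i,k-1}^{-\gamma/2}\boldsymbol\zeta_{i,k}$ and the estimates, for $k=1,\dots,n-1$, $$\hat{\boldsymbol f}_k=\frac{\sum_{i=0}^{n-k}C_{i,k-1}^\gamma \boldsymbol F_{i,k}}{\sum_{i=0}^{n-k}C_{i,k-1}^\gamma},\qquad \hat{\boldsymbol\sigma}_k^2=\frac{1}{n-k}\sum_{i=0}^{n-k}C_{i,k-1}^\gamma(\boldsymbol F_{i,k}-\hat{\boldsymbol f}_k)^2,$$ and $\hat f_n=1$, $\hat\sigma_n=0$. The true next-year payments are $\boldsymbol Z_{i,n-i+1}=\bigl(f_{n-i+1}+\sigma_{n-i+1}C_{i,n-i}^{-\gamma/2}\boldsymbol\zeta_{i,n-i+1}-1\bigr)C_{i,n-i}$ for $1\le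 i\le n$. Modelled quantities: for a fixed realization $\mathcal R$ of $\boldsymbol{\mathcal R}$ (hence fixed $\hat f_k,\hat\sigma_k$), let $\boldsymbol\zeta'_{i,k}$ ($0\le i\le n-k$, $1\le k\le n-1$) and $\boldsymbol\zeta'_{i,n-i+1}$ ($1\le i\le n$) be i.i.d. standard normal, independent of everything above. For $k=1,\dots,n-1$ set $$\boldsymbol R'_k=\sum_{i=0}^{n-k}\boldsymbol\zeta'_{i,k}\frac{\sqrt{C_{i,k-1}^\gamma}}{\sum_{h=0}^{n-k}C_{h,k-1}^\gamma},\qquad \boldsymbol M'_k=\frac{1}{n-k}\sum_{i=0}^{n-k}C_{i,k-1}^\gamma\Bigl(\frac{\boldsymbol\zeta'_{i,k}}{\sqrt{C_{i,k-1}^\gamma}}-\boldsymbol R'_k\Bigr)^2,$$ $(\boldsymbol\sigma_k^{sim})^2=\hat\sigma_k^2/\boldsymbol M'_k$, $\boldsymbol f_k^{sim}=\hat f_k-\boldsymbol\sigma_k^{sim}\boldsymbol R'_k$, and $\boldsymbol f_n^{sim}=1$, $\boldsymbol\sigma_n^{sim}=0$. For $1\le i\le n$ let $\boldsymbol Z^{model}_{i,n-i+1}=\bigl(\boldsymbol f^{sim}_{n-i+1}+\boldsymbol\sigma^{sim}_{n-i+1}C_{i,n-i}^{-\gamma/2}\boldsymbol\zeta'_{i,n-i+1}-1\bigr)C_{i,n-i}$ and $\hat Z_{i,n-i+1}=(\hat f_{n-i+1}-1)C_{i,n-i}$. With $v_{i}=C_{i,n-i}^2\bigl(C_{i,n-i}^{-\gamma}+(\sum_{l=0}^{i-1}C_{l,n-i}^\gamma)^{-1}\bigr)$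 define for $2\le i\le n$ $$w_{n-i+1}=\frac{\sigma_{n-i+1}^2v_i}{\sum_{j=2}^n\sigma_{n-j+1}^2v_j},\qquad \hat w_{n-i+1}=\frac{\hat\sigma_{n-i+1}^2v_i}{\sum_{j=2}^n\hat\sigma_{n-j+1}^2v_j},$$ $$\boldsymbol a_{sim}=\Bigl(\sum_{i=2}^n\frac{\hat w_{n-i+1}}{\boldsymbol M'_{n-i+1}}\cdot\sum_{i=2}^n w_{n-i+1}\boldsymbol M'_{n-i+1}\Bigr)^{-1/2},$$ and $\boldsymbol Z^{model}_{adj}(\mathcal R)=\sum_{i=1}^n\bigl[(1-\boldsymbol a_{sim})\hat Z_{i,n-i+1}+\boldsymbol a_{sim}\boldsymbol Z^{model}_{i,n-i+1}\bigr]$. Let $\mathrm{SCR}_{\boldsymbol Z}(\alpha;\mathcal R)$ denote the $\alpha$-quantile of the distribution of $\boldsymbol Z^{model}_{adj}(\mathcal R)$ (for fixed $\mathcal R$). Then, regardless of the values of the parameters $f_k,\sigma_k$, $$P\Bigl(\sum_{i=1}^n\boldsymbol Z_{i,n-i+1}\le \mathrm{SCR}_{\boldsymbol Z}(\alpha;\boldsymbol{\mathcal R})\Bigr)=\alpha,$$ where the probability is taken over $\boldsymbol{\mathcal R}$ and the $\boldsymbol\zeta_{i,n-i+1}$.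
   Context: This is the normal chain-ladder model for a claims development triangle: $C_{i,k}$ are cumulative claims of accident year $i$ up to development year $k$, observed for $i+k\le n$; all claims are settled after $n$ development years ($f_n=1$, $\sigma_n=0$, so $\boldsymbol Z_{1,n}=0$). The weights $C_{i,k}$ are treated as fixed, only the residues are random. The variable $\sum_i\boldsymbol Z_{i,n-i+1}$ is the true payment of the next calendar year, and $\boldsymbol Z^{model}_{adj}$ is the payment modelled by an adjusted fiducial (''inversion'') method with stochastic correction factor $\boldsymbol a_{sim}$. *)

(* Defs.v *)
From HB Require Import structures.
From mathcomp Require Import all_boot all_order all_algebra.
From mathcomp Require Import all_classical all_reals all_analysis.
From mathcomp Require Import normal_distribution.
Set Implicit Arguments. Unset Strict Implicit. Unset Printing Implicit Defensive.
Import Order.TTheory GRing.Theory Num.Theory.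
Local Open Scope classical_set_scope.
Local Open Scope ring_scope.

Section ChainLadder.
Variable R : realType.

Definition std_normal d (T : measurableType d) (P : probability T R)
    (X : T -> R) : Prop :=
  measurable_fun setT X /\
  forall A : set R, measurable A -> P (X @^-1` A) = normal_prob 0 1 A.

Definition mutually_independent d (T : measurableType d) (P : probability T R)
    (I : eqType) (D : set I) (X : I -> T -> R) : Prop :=
  forall (s : seq I) (B : I -> set R), uniq s ->
    (forall i, i \in s -> D i /\ measurable (B i)) ->
    P (\bigcap_(i in [set j | j \in s]) (X i @^-1` B i)) =
    (\prod_(i <- s) P (X i @^-1` B i))%E.

Definition iid_std_normal d (T : measurableType d) (P : probability T R)
    (I : eqType) (D : set I) (X : I -> T -> R) : Prop :=
  (forall i, D i -> std_normal P (X i)) /\ mutually_independent P D X.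

Definition quantile d (T : measurableType d) (P : probability T R)
    (Y : T -> R) (alpha : R) : R :=
  inf [set x : R | (alpha%:E <= P [set w | (Y w <= x)%R])%E].

Definition obs_idx (n : nat) : set (nat * nat) :=
  [set ik | (1 <= ik.2 <= n.-1)%N /\ (ik.1 <= n - ik.2)%N].
Definition next_idx (n : nat) : set (nat * nat) :=
  [set ik | (1 <= ik.1 <= n)%N /\ ik.2 = (n - ik.1 + 1)%N].
Definition all_idx (n : nat) := obs_idx n `|` next_idx n.

(** Deterministic functions of a realization z of the residues. *)
Variables (n gamma : nat) (C : nat -> nat -> R) (f sigma : nat -> R).

Definition Cg i k := C i k ^+ gamma.
Definition Cmh i k := (Num.sqrt (C i k ^+ gamma))^-1.

Definition Fobs (z : nat * nat -> R) i k :=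
  f k + sigma k * Cmh i k.-1 * z (i, k).

Definition fhat (z : nat * nat -> R) k : R :=
  if k == n then 1 else
  (\sum_(0 <= i < (n - k)%N.+1) Cg i k.-1 * Fobs z i k) /
  (\sum_(0 <= i < (n - k)%N.+1) Cg i k.-1).

Definition sigmahat2 (z : nat * nat -> R) k : R :=
  if k == n then 0 else
  ((n - k)%N%:R)^-1 *
  \sum_(0 <= i < (n - k)%N.+1) Cg i k.-1 * (Fobs z i k - fhat z k) ^+ 2.

Definition Ztrue (z : nat * nat -> R) : R :=
  \sum_(1 <= i < n.+1)
    (f (n - i + 1)%N + sigma (n - i + 1)%N * Cmh i (n - i)%N * z (i, (n - i + 1)%N) - 1)
    * C i (n - i)%N.

(* modelled quantities, z = observed realization, z' = simulated residues *)
Definition Rp (z' : nat * nat -> R) k : R :=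
  \sum_(0 <= i < (n - k)%N.+1)
     z' (i, k) * Num.sqrt (Cg i k.-1) / (\sum_(0 <= h < (n - k)%N.+1) Cg h k.-1).

Definition Mp (z' : nat * nat -> R) k : R :=
  ((n - k)%N%:R)^-1 *
  \sum_(0 <= i < (n - k)%N.+1)
     Cg i k.-1 * (z' (i, k) / Num.sqrt (Cg i k.-1) - Rp z' k) ^+ 2.

Definition sigsim (z z' : nat * nat -> R) k : R :=
  if k == n then 0 else Num.sqrt (sigmahat2 z k / Mp z' k).

Definition fsim (z z' : nat * nat -> R) k : R :=
  if k == n then 1 else fhat z k - sigsim z z' k * Rp z' k.

Definition Zmodel (z z' : nat * nat -> R) i : R :=
  (fsim z z' (n - i + 1)%N + sigsim z z' (n - i + 1)%N * Cmh i (n - i)%N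
     * z' (i, (n - i + 1)%N) - 1) * C i (n - i)%N.

Definition Zhat (z : nat * nat -> R) i : R := (fhat z (n - i + 1)%N - 1) * C i (n - i)%N.

Definition vv i : R :=
  C i (n - i)%N ^+ 2 *
  ((Cg i (n - i)%N)^-1 + (\sum_(0 <= l < i) Cg l (n - i)%N)^-1).

(* w_{n-i+1} and \hat w_{n-i+1}, indexed here by i (2 <= i <= n) *)
Definition ww i : R :=
  sigma (n - i + 1)%N ^+ 2 * vv i /
  (\sum_(2 <= j < n.+1) sigma (n - j + 1)%N ^+ 2 * vv j).

Definition wwhat (z : nat * nat -> R) i : R :=
  sigmahat2 z (n - i + 1)%N * vv i /
  (\sum_(2 <= j < n.+1) sigmahat2 z (n - j + 1)%N * vv j).

Definition asim (z z' : nat * nat -> R) : R :=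
  (Num.sqrt ((\sum_(2 <= i < n.+1) wwhat z i / Mp z' (n - i + 1)%N) *
             (\sum_(2 <= i < n.+1) ww i * Mp z' (n - i + 1)%N)))^-1.

Definition Zadj (z z' : nat * nat -> R) : R :=
  \sum_(1 <= i < n.+1)
    ((1 - asim z z') * Zhat z i + asim z z' * Zmodel z z' i).

End ChainLadder.

(* Main.v *)
Require Import Defs.
From HB Require Import structures.
From mathcomp Require Import all_boot all_order all_algebra.
From mathcomp Require Import all_classical all_reals all_analysis.
From mathcomp Require Import measurable_realfun normal_distribution ring lra zify.
Import Order.TTheory GRing.Theory Num.Theory.
Local Open Scope classical_set_scope.
Local Open Scope ring_scope.

(** In column [k] the observed quantities are [fhat k = f k + sigma k * R_k] and
    [sigmahat2 k = sigma k ^ 2 * M_k], so the prediction error of the next payment is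
    [sum_i sigma_k * N_k] with [N_k = (zeta / sqrt C^gamma - R_k) * C].  An orthogonal change
    of coordinates in each column turns [N_k] into [sqrt v_i] times a standard normal which is
    independent of all [M_k].  Rotating these normals by an angle that depends on the [M_k]
    only shows that every combination [sum_i b_i(M) * N_k] with nonnegative [b_i] is
    [sqrt (sum_i b_i(M)^2 v_i)] times one standard normal independent of the [M_k].
    Hence the error divided by the estimated standard deviation [sqrt (sum_i sigmahat2 v_i)]
    and the model deviation divided by the same number have one common continuous law, that of
    [X / sqrt (sum_i w_i M_k)]: the factor [a_sim] cancels everything else. *)

(** The coefficients [sigsim] of the simulated shocks are functions of the simulated [Mp], so
    Gaussian shocks have to be mixed with random weights. This forces two stages: rotations inside a
    column have constant angles; the coordinates that determine all [Mp] are then absorbed into the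
    conditioning variable, and only the next-diagonal coordinates are rotated further, by angles
    measurable in that variable. The form of [asim] is read off from the second stage. Given M', the
    model deviation has variance sum_i sigmahat2 * v_i / M'_i, which is [totvar] times the first sum
    in [asim]. Multiplying by the square of [asim] leaves [totvar] / sum_i w_i M'_i. On the true
    side [totvar] equals [payvar] * sum_i w_i M_i, so the same denominator appears. For each fixed
    realization the predictive quantile is thus the point forecast plus sqrt([totvar]) * q with one
    nonrandom q, and coverage becomes the event that a single statistic is at most its own quantile
    q. Realizations with [totvar] = 0 are kept: division by zero makes [asim] vanish and the formula
    persists. *)

(** * Rotation invariance of the planar standard Gaussian measure *)

Section rotation_invariance.
Context {R : realType}.
Local Notation leb := (@lebesgue_measure R).
Local Notation mR := (measurableTypeR R).
Local Notation g := (@normal_prob R 0 1).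
Local Notation pdf := (@normal_pdf R 0 1).

Lemma lebesgue_measure_addr (a : R) (A : set R) : measurable A ->
  pushforward leb ((fun x : R => x + a) : _ -> mR) A = leb A.
Proof.
move=> mA.
have mf : measurable_fun setT ((fun x : R => x + a) : _ -> mR).
  by apply: measurable_funD.
apply/esym/lebesgue_measure_unique => //= _ [[l r]] _ <-.
rewrite /pushforward.
have -> : (fun x : R => x + a) @^-1` `]l, r] = `]l - a, r - a]%classic.
  by apply/seteqP; split => x /=; rewrite !in_itv/= ltrBlDr lerBrDr.
rewrite !lebesgue_measure_itv/= !lte_fin ltrD2r; case: ifP => // _.
by rewrite -!EFinD; congr (_%:E); ring.
Qed.

Lemma ge0_integral_addr (a : R) (h : R -> \bar R) :
  measurable_fun setT h -> (forall x, 0 <= h x)%E ->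
  (\int[leb]_x h (x + a)%R = \int[leb]_x h x)%E.
Proof.
move=> mh h0.
have mf : measurable_fun setT ((fun x : R => x + a) : _ -> mR).
  by apply: measurable_funD.
transitivity (\int[pushforward leb ((fun x : R => (x + a)%R) : _ -> mR)]_x h x)%E.
  by rewrite ge0_integral_pushforward ?preimage_setT//= => x _; exact: h0.
by apply: eq_measure_integral => //= A mA _; exact: lebesgue_measure_addr.
Qed.

(** An iterated integral, so that a shear is a translation in one variable while the other is
    fixed. *)
Let dint (h : R * R -> \bar R) := (\int[leb]_x \int[leb]_y h (x, y))%E.

Lemma measurable_shear2 (t : R) (h : R * R -> \bar R) :
  measurable_fun setT h ->
  measurable_fun setT (fun p : R * R => h (p.1, p.2 + t * p.1)).
Proof.
move=> mh; apply: (measurableT_comp mh).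
apply: measurable_fun_pair => //=; apply: measurable_funD => //.
by apply: measurable_funM.
Qed.

Lemma measurable_shear1 (t : R) (h : R * R -> \bar R) :
  measurable_fun setT h ->
  measurable_fun setT (fun p : R * R => h (p.1 + t * p.2, p.2)).
Proof.
move=> mh; apply: (measurableT_comp mh).
apply: measurable_fun_pair => //=; apply: measurable_funD => //.
by apply: measurable_funM.
Qed.

Lemma ge0_integral_shear2 (t : R) (h : R * R -> \bar R) :
  measurable_fun setT h -> (forall p, 0 <= h p)%E ->
  dint (fun p : R * R => h (p.1, p.2 + t * p.1)) = dint h.
Proof.
move=> mh h0; apply: eq_integral => x _ /=.
rewrite (ge0_integral_addr (t * x) (fun y => h (x, y)))//.
exact: measurable_fun_pair2.
Qed.

Lemma ge0_integral_shear1 (t : R) (h : R * R -> \bar R) :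
  measurable_fun setT h -> (forall p, 0 <= h p)%E ->
  dint (fun p : R * R => h (p.1 + t * p.2, p.2)) = dint h.
Proof.
move=> mh h0.
have swap (k : R * R -> \bar R) : measurable_fun setT k -> (forall p, 0 <= k p)%E ->
    dint k = (\int[leb]_y \int[leb]_x k (x, y))%E.
  by move=> mk k0; exact: (@fubini_tonelli _ _ mR mR R leb leb k).
(* Here the outer variable is translated, so Tonelli exchanges the order of integration first. *)
rewrite (swap _ (measurable_shear1 t h mh) (fun p => h0 _)) (swap h mh h0).
apply: eq_integral => y _ /=.
apply: (ge0_integral_addr (t * y) (fun x => h (x, y))) => [|x]; last exact: h0.
exact: measurable_fun_pair1.
Qed.

(* A rotation is a product of three shears. *)
Lemma ge0_integral_rotation (c s : R) (h : R * R -> \bar R) :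
  measurable_fun setT h -> (forall p, 0 <= h p)%E ->
  0 <= c -> c ^+ 2 + s ^+ 2 = 1 ->
  dint (fun p : R * R => h (c * p.1 + s * p.2, - s * p.1 + c * p.2)) = dint h.
Proof.
move=> mh h0 c0 cs.
have c1 : 1 + c != 0 by rewrite gt_eqF// ltr_wpDr.
(* The tangent of half the angle; [0 <= c] keeps the denominator away from zero. *)
pose t := s / (1 + c).
pose h1 (p : R * R) := h (p.1 + t * p.2, p.2).
pose h2 (p : R * R) := h1 (p.1, p.2 + - s * p.1).
pose h3 (p : R * R) := h2 (p.1 + t * p.2, p.2).
have mh1 : measurable_fun setT h1 by exact: measurable_shear1.
have mh2 : measurable_fun setT h2 by exact: measurable_shear2.
have e1 : dint h1 = dint h by exact: ge0_integral_shear1.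
have e2 : dint h2 = dint h1 by exact: (ge0_integral_shear2 (- s) h1 mh1 (fun p => h0 _)).
have e3 : dint h3 = dint h2 by exact: (ge0_integral_shear1 t h2 mh2 (fun p => h0 _)).
transitivity (dint h3); last exact: (etrans e3 (etrans e2 e1)).
have s2 : s ^+ 2 = 1 - c ^+ 2 by rewrite -cs; ring.
have st : s * t = 1 - c.
  by rewrite /t mulrA -expr2 s2; field.
have tc : t * c = s - t by rewrite /t; field.
have E (x y : R) : h (c * x + s * y, - s * x + c * y) = h3 (x, y).
  rewrite /h3 /h2 /h1 /=; congr (h (_, _)).
  - rewrite [RHS](_ : _ = (1 - s * t) * x + (t + t * (1 - s * t)) * y); last by ring.
    by rewrite st opprB addrCA subrr addr0 tc; ring.
  - rewrite [RHS](_ : _ = - s * x + (1 - s * t) * y); last by ring.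
    by rewrite st; ring.
by apply: eq_integral => x _; apply: eq_integral => y _; exact: E.
Qed.

(** The Radon-Nikodym derivative and the explicit density have the same integral over every
    measurable set, hence agree almost everywhere. *)
Lemma ge0_integral_normal_prob (f : mR -> \bar R) :
  measurable_fun setT f -> (forall x, 0 <= f x)%E ->
  (\int[g]_x f x = \int[leb]_x (f x * (pdf x)%:E))%E.
Proof.
move=> mf f0.
have dom := @normal_prob_dominates R 0 1.
rewrite -(Radon_Nikodym_SigmaFinite.change_of_variables dom)//=.
have mpdf : measurable_fun setT (EFin \o pdf).
  by apply/measurable_EFinP; exact: measurable_normal_pdf.
have idRN := Radon_Nikodym_SigmaFinite.f_integrable dom.
have mdRN := measurable_int _ idRN.
apply: ae_eq_integral => //; try by apply: emeasurable_funM.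
apply: ae_eqe_mul2l => /=.
apply: integral_ae_eq => //= E _ mE.
by rewrite -Radon_Nikodym_SigmaFinite.f_integral.
Qed.

(** The product density depends on x^2 + y^2 only, which a rotation preserves. *)
Lemma normal_pdf_rotation (c s x y : R) : c ^+ 2 + s ^+ 2 = 1 ->
  pdf (c * x + s * y) * pdf (- s * x + c * y) = pdf x * pdf y.
Proof.
move=> cs; rewrite !normal_pdfE ?oner_eq0// /normal_fun !subr0.
rewrite mulrACA -expRD [RHS]mulrACA -expRD; congr (_ * expR _).
rewrite -!mulrDl; congr (_ / _).
have -> : - (c * x + s * y) ^+ 2 - (- s * x + c * y) ^+ 2 =
    - (c ^+ 2 + s ^+ 2) * (x ^+ 2 + y ^+ 2) by ring.
by rewrite cs; ring.
Qed.

Lemma normal_prob_dint (A : set (R * R)) : measurable A ->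
  (g \x g)%E A = dint (fun p : R * R => (\1_A p * (pdf p.1 * pdf p.2))%:E).
Proof.
move=> mA; rewrite /product_measure1.
transitivity (\int[leb]_x (g (xsection A x) * (pdf x)%:E))%E.
  apply: (ge0_integral_normal_prob (g \o xsection A)) => //.
  exact: measurable_fun_xsection.
apply: eq_integral => x _.
have -> : g (xsection A x) = (\int[leb]_y ((\1_(xsection A x) y)%:E * (pdf y)%:E))%E.
  have mx : measurable (xsection A x : set mR) by exact: measurable_xsection.
  have := @ge0_integral_normal_prob (fun y => (\1_(xsection A x) y)%:E) _ _.
  rewrite integral_indic// setIT => ->//.
  by apply/measurable_EFinP; exact: measurable_indic.
rewrite -ge0_integralZr//; last 3 first.
- suff mf : measurable_fun setT (EFin \o (fun y : mR => \1_(xsection A x) y * pdf y)) by exact: mf.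
  apply/measurable_EFinP; apply: measurable_funM; last exact: measurable_normal_pdf.
  by apply: measurable_indic; exact: measurable_xsection.
- by move=> y _; rewrite -EFinM lee_fin mulr_ge0// ?normal_pdf_ge0.
- by rewrite lee_fin normal_pdf_ge0.
apply: eq_integral => y _ /=.
rewrite -!EFinM; congr (_%:E).
have -> : \1_(xsection A x) y = \1_A (x, y) :> R by rewrite !indicE mem_xsection.
ring.
Qed.

Lemma normal_prob_rotation (c s : R) (A : set (R * R)) : measurable A ->
  0 <= c -> c ^+ 2 + s ^+ 2 = 1 ->
  (g \x g)%E ((fun p => (c * p.1 + s * p.2, - s * p.1 + c * p.2)) @^-1` A) =
  (g \x g)%E A.
Proof.
move=> mA c0 cs.
have mr : measurable_fun setT (fun p : R * R => (c * p.1 + s * p.2, - s * p.1 + c * p.2)).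
  by apply: measurable_fun_pair; apply: measurable_funD; apply: measurable_funM.
have mA' := mr measurableT _ mA; rewrite setTI in mA'.
rewrite (normal_prob_dint _ mA') (normal_prob_dint _ mA).
have mpd : measurable_fun setT pdf by exact: measurable_normal_pdf.
pose h (p : R * R) := (\1_A p * (pdf p.1 * pdf p.2))%:E.
transitivity (dint (fun p : R * R => h (c * p.1 + s * p.2, - s * p.1 + c * p.2))).
  apply: eq_integral => x _; apply: eq_integral => y _; rewrite /h /=.
  by rewrite -(normal_pdf_rotation c s x y)// !indicE; congr (((_ \in _)%:R * _)%:E).
apply: (ge0_integral_rotation c s h) => //.
- apply/measurable_EFinP; apply: measurable_funM; first exact: measurable_indic.
  by apply: measurable_funM; exact: measurableT_comp mpd _.
- by move=> p; rewrite lee_fin mulr_ge0// mulr_ge0// normal_pdf_ge0.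
Qed.

End rotation_invariance.

(* [normal_prob] is a measure on [measurableTypeR R]; random variables take
   values in [R] with its own measurable structure, of another display. *)
Definition gauss {R : realType} : set R -> \bar R := normal_prob 0 1.

Section gauss_measure.
Context {R : realType}.

Let gauss0 : gauss (set0 : set R) = 0%E.
Proof. exact: (measure0 (normal_prob (0 : R) 1)). Qed.

Let gauss_ge0 (A : set R) : (0 <= gauss A)%E.
Proof. exact: (measure_ge0 (normal_prob (0 : R) 1)). Qed.

Let gauss_additive : semi_sigma_additive (@gauss R).
Proof.
move=> F mF tF mU.
exact: (@measure_semi_sigma_additive _ _ _ (normal_prob (0 : R) 1) F mF tF mU).
Qed.

HB.instance Definition _ :=
  isMeasure.Build _ R R (@gauss R) gauss0 gauss_ge0 gauss_additive.

Lemma gaussT : gauss [set: R] = 1%E.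
Proof. exact: (@probability_setT _ _ _ (normal_prob (0 : R) 1)). Qed.

HB.instance Definition _ := @Measure_isProbability.Build _ R R (@gauss R) gaussT.

Definition gauss2 : set (R * R)%type -> \bar R := (gauss \x gauss)%E.

HB.instance Definition _ := Measure.copy gauss2 (gauss \x gauss)%E.

Lemma gauss2X (B1 B2 : set R) : measurable B1 -> measurable B2 ->
  gauss2 (B1 `*` B2) = (gauss B1 * gauss B2)%E.
Proof. exact: product_measure1E. Qed.

Let gauss2T : gauss2 setT = 1%E.
Proof. by rewrite -setXTT gauss2X// !gaussT mule1. Qed.

HB.instance Definition _ :=
  @Measure_isProbability.Build _ (R * R)%type R gauss2 gauss2T.

Lemma gauss2_rotation (c s : R) (A : set (R * R)) : measurable A ->
  0 <= c -> c ^+ 2 + s ^+ 2 = 1 ->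
  gauss2 ((fun p => (c * p.1 + s * p.2, - s * p.1 + c * p.2)) @^-1` A) =
  gauss2 A.
Proof.
move=> mA c0 cs.
pose nu := (normal_prob (0 : R) 1 \x normal_prob (0 : R) 1)%E.
have mid : measurable_fun setT
  (idfun : measurableTypeR R * measurableTypeR R -> R * R) by exact: measurable_id.
(* The two product measures live on measurable structures of different displays; pushing [nu] along
   the identity and comparing rectangles identifies them. *)
have gE W : measurable W -> gauss2 W = nu W.
  move=> mW; transitivity (pushforward nu
    (idfun : measurableTypeR R * measurableTypeR R -> R * R) W); last by [].
  by apply: product_measure_unique => // B1 B2 mB1 mB2; exact: product_measure1E.
have mr : measurable_fun setT (fun p : R * R => (c * p.1 + s * p.2, - s * p.1 + c * p.2)).
  by apply: measurable_fun_pair; apply: measurable_funD; apply: measurable_funM.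
have mA' := mr measurableT _ mA; rewrite setTI in mA'.
rewrite (gE _ mA') (gE _ mA).
exact: normal_prob_rotation.
Qed.

Lemma gauss_set1 (x : R) : gauss [set x] = 0%E.
Proof.
have /null_content_dominatesP := @normal_prob_dominates R 0 1; apply => //.
exact: lebesgue_measure_set1.
Qed.

End gauss_measure.

(** * Joint laws, and rotation by an angle depending on an independent variable *)

Section joint_laws.
Context {R : realType}.
Local Notation g := (@gauss R).
Local Notation g2 := (@gauss2 R).

Lemma measurable_preimage d e (T : measurableType d) (E : measurableType e)
    (f : T -> E) (A : set E) :
  measurable_fun setT f -> measurable A -> measurable (f @^-1` A).
Proof. by move=> mf mA; rewrite -[X in measurable X]setTI; exact: mf. Qed.

Lemma pi_system_measure_unique d (T : measurableType d) (G : set (set T))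
    (m1 m2 : {measure set T -> \bar R}) :
  @measurable _ T = <<s G >> -> setI_closed G -> G setT ->
  (m1 setT < +oo)%E -> (forall A, G A -> m1 A = m2 A) ->
  forall A, measurable A -> m1 A = m2 A.
Proof.
move=> mG GI GT m1oo m12 A mA.
by apply: (measure_unique G (fun=> setT)) => //; rewrite bigcup_const//; exists 0%N.
Qed.

Lemma product_measure_ext d e (T1 : measurableType d) (T2 : measurableType e)
    (m1 m2 : {measure set (T1 * T2) -> \bar R}) : (m1 setT < +oo)%E ->
  (forall A B, measurable A -> measurable B -> m1 (A `*` B) = m2 (A `*` B)) ->
  forall W, measurable W -> m1 W = m2 W.
Proof.
move=> m1oo m12.
apply: (pi_system_measure_unique _ _
  [set C | exists A, measurable A /\ exists B, measurable B /\ C = A `*` B]) => //.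
- rewrite measurable_prod_measurableType //; congr (<<s _ >>).
  rewrite predeqE; split => [[A mA [B mB <-]]|[A [mA [B [mB ->]]]]].
    by exists A; split => //; exists B.
  by exists A => //; exists B.
- move=> /= _ _ [X1 [mX1 [X2 [mX2 ->]]]] [Y1 [mY1 [Y2 [mY2 ->]]]].
  rewrite -setXI; exists (X1 `&` Y1); split; first exact: measurableI.
  by exists (X2 `&` Y2); split => //; exact: measurableI.
- by exists setT; split => //; exists setT; split => //; rewrite setXTT.
- by move=> _ [A [mA [B [mB ->]]]]; exact: m12.
Qed.

Definition pushforward_measure d e (T : measurableType d) (E : measurableType e)
    (mu : {measure set T -> \bar R}) (f : T -> E) (mf : measurable_fun setT f) :
  {measure set E -> \bar R}.
Proof. by unshelve refine (pushforward mu f : {measure set E -> \bar R}). Defined.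

Arguments pushforward_measure {d e T E} mu {f} mf.

Section conditional_rotation.
Context d e (T : measurableType d) (E : measurableType e).
Variables (mu : {finite_measure set T -> \bar R}) (V : T -> E) (X Y : T -> R).
Hypotheses (mV : measurable_fun setT V) (mX : measurable_fun setT X)
  (mY : measurable_fun setT Y).
Hypothesis indVXY : forall A B1 B2, measurable A -> measurable B1 -> measurable B2 ->
  mu (V @^-1` A `&` (X @^-1` B1 `&` Y @^-1` B2)) = (mu (V @^-1` A) * (g B1 * g B2))%E.

Let XY w := (X w, Y w).
Let mXY : measurable_fun setT XY. Proof. exact: measurable_fun_pair. Qed.
Let VXY w := (V w, XY w).
Let mVXY : measurable_fun setT VXY. Proof. exact: measurable_fun_pair. Qed.

(** With [A] fixed, both sides are finite measures in [W], so agreement on rectangles extends to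
    every measurable set of the plane. *)
Let lawXY A (W : set (R * R)) : measurable A -> measurable W ->
  mu (V @^-1` A `&` XY @^-1` W) = (mu (V @^-1` A) * g2 W)%E.
Proof.
move=> mA; have mVA : measurable (V @^-1` A) by exact: measurable_preimage.
have r0 : 0 <= fine (mu (V @^-1` A)) by rewrite fine_ge0.
have rE : (mu (V @^-1` A) = (NngNum r0)%:num%:E)%E by rewrite /= fineK// fin_num_measure.
move: W; suff H W : measurable W ->
    pushforward (mrestr mu mVA) XY W = mscale (NngNum r0) g2 W.
  by move=> W mW; rewrite rE -[RHS]H// setIC.
apply: product_measure_ext W.
- rewrite -ge0_fin_numE//; apply: (fin_num_measure mu); apply: measurableI => //.
  exact: measurable_preimage mXY _.
- move=> B1 B2 mB1 mB2; rewrite /= /mscale/= gauss2X// -rE -indVXY//.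
  by rewrite setIC.
Qed.

(** The joint law of [V] and the pair is a product. By Fubini it is enough to look at the section
    over one value [v], where the angle is constant and [gauss2_rotation] applies. *)
Lemma measure_rotate (c s : E -> R) A B1 B2 :
  measurable_fun setT c -> measurable_fun setT s ->
  (forall v, 0 <= c v) -> (forall v, c v ^+ 2 + s v ^+ 2 = 1) ->
  measurable A -> measurable B1 -> measurable B2 ->
  mu (V @^-1` A `&` ((fun w => c (V w) * X w + s (V w) * Y w) @^-1` B1 `&`
                     (fun w => - s (V w) * X w + c (V w) * Y w) @^-1` B2)) =
  (mu (V @^-1` A) * (g B1 * g B2))%E.
Proof.
move=> mc ms c0 cs mA mB1 mB2.
pose Q := pushforward_measure mu mV.
pose h (p : E * (R * R)) := (c p.1 * p.2.1 + s p.1 * p.2.2, - s p.1 * p.2.1 + c p.1 * p.2.2).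
have mh : measurable_fun setT h.
  have m1 := @measurable_fst _ _ E (R * R)%type.
  have m21 := measurableT_comp (@measurable_fst _ _ R R) (@measurable_snd _ _ E (R * R)%type).
  have m22 := measurableT_comp (@measurable_snd _ _ R R) (@measurable_snd _ _ E (R * R)%type).
  have mc1 := measurableT_comp mc m1.
  have ms1 := measurableT_comp ms m1.
  apply: measurable_fun_pair; apply: measurable_funD; apply: measurable_funM => //.
  exact: measurableT_comp ms1.
pose W := fst @^-1` A `&` h @^-1` (B1 `*` B2).
have mB : measurable (B1 `*` B2) by exact: measurableX.
have mW : measurable W.
  by apply: measurableI; exact: measurable_preimage.
have QE U : measurable U -> mu (VXY @^-1` U) = (Q \x g2)%E U.
  move: U; refine (product_measure_ext _ _ _ _ (pushforward_measure mu mVXY) (Q \x g2)%E _ _).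
    rewrite -ge0_fin_numE//; apply: (fin_num_measure mu).
    exact: measurable_preimage mVXY _.
  move=> A' W' mA' mW'; transitivity (Q A' * g2 W')%E; last first.
    by apply/esym; exact: product_measure1E.
  exact: lawXY.
transitivity (mu (VXY @^-1` W)); first by [].
rewrite QE//.
transitivity ((Q \x g2)%E (A `*` (B1 `*` B2))); last first.
  by rewrite -gauss2X//; exact: product_measure1E.
apply: eq_integral => v _; rewrite /=.
have [vA|vA] := pselect (A v); last first.
  have -> : xsection W v = set0.
    by rewrite -subset0 => p; rewrite /xsection/= inE => -[].
  have -> : xsection (A `*` (B1 `*` B2)) v = set0.
    by rewrite -subset0 => p; rewrite /xsection/= inE => -[].
  by [].
have -> : xsection (A `*` (B1 `*` B2)) v = B1 `*` B2 by exact: in_xsectionX (mem_set vA).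
rewrite -[RHS](gauss2_rotation (c v) (s v) _ mB (c0 v) (cs v)).
congr (_ _); apply/seteqP; split => p; rewrite /xsection/= inE.
  by case.
by move=> ?; split.
Qed.

End conditional_rotation.
End joint_laws.
Arguments pushforward_measure {R d e T E} mu {f} mf.
Arguments pi_system_measure_unique {R d T} G.
Arguments product_measure_ext {R d e T1 T2}.
Arguments measure_rotate {R d e T E} mu {V X Y} mV mX mY indVXY {c s A B1 B2}.

(** * Measurability of square root, inverse and finite sums *)

Section measurable_arith.
Context {R : realType}.

Lemma measurable_sqrtr : measurable_fun setT (@Num.sqrt R).
Proof. by apply: continuous_measurable_fun; exact: sqrt_continuous. Qed.

Lemma measurable_invr : measurable_fun setT (@GRing.inv R).
Proof.
(* The inverse is reduced to a real power of x^2; the identity holds at 0 too, since the inverse of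
   0 is 0. *)
have -> : @GRing.inv R = (fun x : R => x * ((x ^+ 2) `^ (- 1))).
  apply/funext => x; rewrite powR_inv1 ?sqr_ge0//.
  by have [->|x0] := eqVneq x 0; [rewrite invr0 mul0r|field].
apply: measurable_funM => //.
have m2 : measurable_fun setT (fun x : R => x ^+ 2) by exact: measurable_funX.
have mp : measurable_fun setT (fun x : R => x `^ (- 1)) by exact: measurable_powR.
exact: (measurableT_comp mp m2).
Qed.

Lemma measurable_sum_seq d (T : measurableType d) (I : eqType) (s : seq I)
    (h : I -> T -> R) : (forall i, i \in s -> measurable_fun setT (h i)) ->
  measurable_fun setT (fun w => \sum_(i <- s) h i w).
Proof.
elim: s => [|i s ih] mh; first by under eq_fun do rewrite big_nil; exact: measurable_cst.
under eq_fun do rewrite big_cons.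
apply: measurable_funD; first by apply: mh; rewrite inE eqxx.
by apply: ih => k ks; apply: mh; rewrite inE ks orbT.
Qed.

End measurable_arith.

Set Implicit Arguments.
Unset Strict Implicit.

(** * Families of independent normals and their orthogonal recombination *)

Section independent_normals.
Context {R : realType} {I : choiceType}.
Local Notation g := (@gauss R).
Local Open Scope ereal_scope.

Definition box (T : Type) (X : I -> T -> R) (s : seq I) (B : I -> set R) : set T :=
  [set w | forall i, i \in s -> B i (X i w)].

Lemma box_nil (T : Type) (X : I -> T -> R) B : box X [::] B = setT.
Proof. by apply/seteqP; split. Qed.

Lemma box_cons (T : Type) (X : I -> T -> R) i s B :
  box X (i :: s) B = X i @^-1` B i `&` box X s B.
Proof.
apply/seteqP; split => [w h|w [h1 h2] k]; last by rewrite inE => /predU1P[->//|]; exact: h2.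
by split=> [|k ks]; apply: h; rewrite inE ?eqxx// ks orbT.
Qed.

Lemma eq_mem_box (T : Type) (X : I -> T -> R) s t B : s =i t -> box X s B = box X t B.
Proof. by move=> st; apply/seteqP; split => w h k ks; apply: h; rewrite ?st// -st. Qed.

Lemma eq_box (T : Type) (X Y : I -> T -> R) s B :
  (forall k, k \in s -> X k =1 Y k) -> box X s B = box Y s B.
Proof.
by move=> XY; apply/seteqP; split => w h k ks; have := h k ks; rewrite XY.
Qed.

Lemma measurable_box d (T : measurableType d) (X : I -> T -> R) s B :
  (forall i, i \in s -> measurable_fun setT (X i)) -> (forall i, measurable (B i)) ->
  measurable (box X s B).
Proof.
elim: s => [|i s ih] mX mB; first by rewrite box_nil.
rewrite box_cons; apply: measurableI.
  by apply: measurable_preimage => //; apply: mX; rewrite inE eqxx.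
by apply: ih => // k ks; apply: mX; rewrite inE ks orbT.
Qed.

Section definition.
Context d e (T : measurableType d) (E : measurableType e) (P : probability T R).

(* The coordinates in [D] are i.i.d. standard normal and jointly independent of [V]. *)
Definition indep_normal (V : T -> E) (D : set I) (X : I -> T -> R) :=
  [/\ measurable_fun setT V, (forall i, D i -> measurable_fun setT (X i)) &
  forall A s B, measurable A -> uniq s -> (forall i, i \in s -> D i) ->
    (forall i, measurable (B i)) ->
    P (V @^-1` A `&` box X s B) = P (V @^-1` A) * \prod_(i <- s) g (B i)].

(* Adding unconstrained coordinates to a box changes neither side. *)
Lemma indep_normalP (F : seq I) V D X : measurable_fun setT V ->
  (forall i, D i -> measurable_fun setT (X i)) -> (forall i, i \in F -> D i) ->
  (forall A s B, measurable A -> uniq s -> (forall i, i \in s -> D i) ->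
    {subset F <= s} -> (forall i, measurable (B i)) ->
    P (V @^-1` A `&` box X s B) = P (V @^-1` A) * \prod_(i <- s) g (B i)) ->
  indep_normal V D X.
Proof.
move=> mV mX FD H; split=> // A s B mA us sD mB.
pose s' := undup (F ++ s); pose B' k := if k \in s then B k else setT.
have s's k : k \in s' = (k \in F) || (k \in s) by rewrite mem_undup mem_cat.
have -> : box X s B = box X s' B'.
  apply/seteqP; split => w h k ks; last first.
    by have := h k; rewrite s's ks orbT /B' ks; apply.
  by rewrite /B'; case: ifPn => // /h.
rewrite H ?undup_uniq//.
- congr (_ * _); rewrite (eq_bigr (fun k => if k \in s then g (B k) else 1)); last first.
    by move=> k _; rewrite /B'; case: ifPn => // _; exact: gaussT.
  rewrite -big_mkcond -big_filter; apply: perm_big; apply: uniq_perm => //.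
    by rewrite filter_uniq// undup_uniq.
  by move=> k; rewrite mem_filter s's; case: (k \in s); rewrite ?orbT// orbF.
- by move=> k; rewrite s's => /orP[/FD|/sD].
- by move=> k kF; rewrite s's kF.
- by move=> k; rewrite /B'; case: ifP.
Qed.

(** Only boxes constraining both [i] and [j] have to be tested. The event about the remaining
    coordinates is untouched by the rotation, so [P] can be restricted to it, which leaves the
    two-coordinate statement [measure_rotate]. *)
Lemma indep_normal_rotate V D X i j (c s : E -> R) : indep_normal V D X ->
  i != j -> D i -> D j -> measurable_fun setT c -> measurable_fun setT s ->
  (forall v, (0 <= c v)%R) -> (forall v, (c v ^+ 2 + s v ^+ 2 = 1)%R) ->
  indep_normal V D (fun k w =>
    if k == i then (c (V w) * X i w + s (V w) * X j w)%R
    else if k == j then (- s (V w) * X i w + c (V w) * X j w)%R else X k w).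
Proof.
move=> [mV mX indX] ij Di Dj mc ms c0 cs.
have mcV := measurableT_comp mc mV.
have msV := measurableT_comp ms mV.
apply: (@indep_normalP [:: i; j]) => //.
- move=> k Dk; case: eqVneq => [_|_]; [|case: eqVneq => [_|_]]; last exact: mX.
    by apply: measurable_funD; apply: measurable_funM => //; exact: mX.
  apply: measurable_funD; apply: measurable_funM; try exact: mX; last by [].
  exact: measurableT_comp msV.
- by move=> k; rewrite !inE => /orP[] /eqP ->.
move=> A t B mA ut tD ijt mB.
pose t0 := [seq k <- t | (k != i) && (k != j)].
have pt : perm_eq t (i :: j :: t0).
  apply: uniq_perm => //=.
    by rewrite inE negb_or ij !mem_filter !eqxx andbF/= filter_uniq.
  move=> k; rewrite !inE mem_filter; have [->|ki] /= := eqVneq k i.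
    by rewrite ijt// inE eqxx.
  by have [->|kj] //= := eqVneq k j; rewrite ijt// !inE eqxx orbT.
rewrite (perm_big _ pt)/= (eq_mem_box _ _ (perm_mem pt)) !big_cons !box_cons.
rewrite eqxx (eq_sym j) (negbTE ij) eqxx.
rewrite (_ : box _ t0 B = box X t0 B); last first.
  apply: eq_box => k; rewrite mem_filter => /andP[/andP[ki kj] _] w.
  by rewrite (negbTE ki) (negbTE kj).
have t0D k : k \in t0 -> D k by rewrite mem_filter => /andP[_]; exact: tD.
have ut0 : uniq [:: i, j & t0] by rewrite -(perm_uniq pt).
have mt0 : measurable (box X t0 B) by apply: measurable_box => // k /t0D; exact: mX.
have Poo : P (box X t0 B) < +oo by rewrite -ge0_fin_numE// fin_num_measure.
pose mu := mfrestr mt0 Poo.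
have H A' B1 B2 : measurable A' -> measurable B1 -> measurable B2 ->
    mu (V @^-1` A' `&` (X i @^-1` B1 `&` X j @^-1` B2)) = mu (V @^-1` A') * (g B1 * g B2).
  move=> mA' mB1 mB2.
  pose B' k := if k == i then B1 else if k == j then B2 else B k.
  have B't0 : {in t0, forall k, B' k = B k}.
    move=> k; rewrite mem_filter /B' => /andP[/andP[ki kj] _].
    by rewrite (negbTE ki) (negbTE kj).
  have bt0 : box X t0 B' = box X t0 B.
    by apply/seteqP; split => w h k kt; have := h k kt; rewrite B't0.
  have mB' k : measurable (B' k) by rewrite /B'; case: ifP => // _; case: ifP.
  have := (fun mA => indX A' [:: i, j & t0] B' mA ut0).
  have B'i : B' i = B1 by rewrite /B' eqxx.
  have B'j : B' j = B2 by rewrite /B' eq_sym (negbTE ij) eqxx.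
  have tD' k : k \in [:: i, j & t0] -> D k.
    by rewrite !inE => /or3P[/eqP->|/eqP->|/t0D].
  rewrite !box_cons bt0 !big_cons B'i B'j => /(_ mA' tD' mB').
  rewrite /mu /mfrestr /mrestr -!setIA => ->.
  rewrite indX//; last by have /= /and3P[] := ut0.
  have -> : \prod_(k <- t0) g (B' k) = \prod_(k <- t0) g (B k).
    by apply: eq_big_seq => k /B't0 ->.
  by rewrite -[RHS]muleA; congr (_ * _); rewrite muleA muleC.
have := measure_rotate (mfrestr mt0 Poo) mV (mX i Di) (mX j Dj) H mc ms c0 cs mA (mB i) (mB j).
rewrite /= /mfrestr /mrestr -!setIA => ->.
rewrite indX//; last by have /= /and3P[] := ut0.
by rewrite -[LHS]muleA; congr (_ * _); rewrite muleC muleA.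
Qed.

Local Open Scope ring_scope.

(* Rotates the coordinates of [l] one after the other into [j0]; the angles depend on [V] only. *)
Lemma indep_normal_combine V D X (a : I -> E -> R) j0 l : indep_normal V D X ->
  uniq (j0 :: l) -> (forall i, i \in j0 :: l -> D i) ->
  (forall i, measurable_fun setT (a i)) -> (forall v, (0 <= a j0 v)%R) ->
  exists X', [/\ indep_normal V D X', (forall i, i \notin j0 :: l -> X' i = X i),
    (forall w, (\sum_(i <- j0 :: l) a i (V w) * X i w =
       Num.sqrt (\sum_(i <- j0 :: l) a i (V w) ^+ 2) * X' j0 w)%R) &
    (forall w, (\sum_(i <- j0 :: l) X' i w ^+ 2 = \sum_(i <- j0 :: l) X i w ^+ 2)%R)].
Proof.
elim: l X a => [|i l ih] X a indX ujl jlD ma a0.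
  by exists X; split => // w; rewrite !big_seq1 sqrtr_sqr ger0_norm.
(* [b] is the length of the vector ([a j0], [a i]) and ([c], [s]) its direction. Where the length is
   0 the angle is set to 0; [bc] and [bs] survive because both components vanish there. *)
pose b v := Num.sqrt (a j0 v ^+ 2 + a i v ^+ 2).
have b2 v : (b v ^+ 2 = a j0 v ^+ 2 + a i v ^+ 2)%R by rewrite sqr_sqrtr// addr_ge0// sqr_ge0.
have mb : measurable_fun setT b.
  apply: (measurableT_comp measurable_sqrtr).
  by apply: measurable_funD; apply: measurable_funX.
have mbi : measurable_fun setT (fun v => (b v)^-1).
  exact: (measurableT_comp measurable_invr).
have mb0 : measurable_fun setT (fun v => b v == 0%R) by exact: measurable_fun_eqr.
pose c v := if b v == 0%R then 1%R else (a j0 v / b v)%R.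
pose s v := if b v == 0%R then 0%R else (a i v / b v)%R.
have mc : measurable_fun setT c.
  by apply: measurable_fun_ifT => //; exact: measurable_funM.
have ms : measurable_fun setT s.
  by apply: measurable_fun_ifT => //; exact: measurable_funM.
have c0 v : (0 <= c v)%R.
  by rewrite /c; case: ifP => // _; rewrite divr_ge0// sqrtr_ge0.
have cs v : (c v ^+ 2 + s v ^+ 2 = 1)%R.
  rewrite /c /s; case: ifPn => [_|bv]; first by rewrite expr0n expr1n addr0.
  by rewrite !expr_div_n -mulrDl -b2 divff// expf_neq0.
have bc v : (b v * c v = a j0 v)%R.
  rewrite /c; case: ifPn => [/eqP bv|bv]; last by rewrite mulrCA divff// mulr1.
  by have := b2 v; rewrite bv mul0r; nra.
have bs v : (b v * s v = a i v)%R.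
  rewrite /s; case: ifPn => [/eqP bv|bv]; last by rewrite mulrCA divff// mulr1.
  by have := b2 v; rewrite bv mul0r; nra.
have [ji jl il ul] : [/\ j0 != i, j0 \notin l, i \notin l & uniq l].
  by move: ujl => /=; rewrite inE negb_or => /andP[/andP[-> ->] /andP[-> ->]].
have Dj : D j0 by apply: jlD; rewrite inE eqxx.
have Di : D i by apply: jlD; rewrite !inE eqxx orbT.
have indY := indep_normal_rotate indX ji Dj Di mc ms c0 cs.
set Y := (fun k w => if k == j0 then _ else _) in indY.
(* After this rotation the pair contributes [b] times the new coordinate [j0]. As [b] is
   nonnegative, the induction hypothesis applies to the remaining list. *)
pose a' k := if k == j0 then b else a k.
have Yl k : k != j0 -> k != i -> Y k = X k.
  by move=> kj ki; apply/funext => w; rewrite /Y (negbTE kj) (negbTE ki).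
have kl k : k \in l -> k != j0 /\ k != i.
  by move=> kl; split; apply: contraTneq kl => ->.
have [||||X' [indX' X'Y sumX' sqX']] := ih Y a' indY.
- by rewrite /= jl.
- by move=> k; rewrite inE => /orP[/eqP->//|kkl]; apply: jlD; rewrite !inE kkl !orbT.
- by move=> k; rewrite /a'; case: ifP.
- by move=> v; rewrite /a' eqxx sqrtr_ge0.
exists X'; split => //.
- by move=> k; rewrite !inE !negb_or => /and3P[kj ki kkl]; rewrite X'Y ?Yl// inE negb_or kj.
- move=> w.
  have sumE : (\sum_(k <- [:: j0, i & l]) a k (V w) * X k w =
      \sum_(k <- j0 :: l) a' k (V w) * Y k w)%R.
    rewrite !big_cons addrA; congr (_ + _)%R.
      rewrite /a' /Y eqxx -{1}bc -{1}bs; ring.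
    by apply: eq_big_seq => k /kl[kj ki]; rewrite /a' (negbTE kj) Yl.
  have sqE : (\sum_(k <- [:: j0, i & l]) a k (V w) ^+ 2 =
      \sum_(k <- j0 :: l) a' k (V w) ^+ 2)%R.
    rewrite !big_cons addrA; congr (_ + _)%R.
      by rewrite /a' eqxx b2.
    by apply: eq_big_seq => k /kl[kj ki]; rewrite /a' (negbTE kj).
  by rewrite sumE sqE.
- move=> w.
  have X'i : X' i = Y i by apply: X'Y; rewrite inE negb_or eq_sym ji.
  have := sqX' w; rewrite !big_cons => sq; rewrite [LHS]addrCA sq X'i [LHS]addrCA !addrA.
  congr (_ + _)%R; last by apply: eq_big_seq => k /kl[kj ki]; rewrite Yl.
  rewrite /Y eqxx (eq_sym i) (negbTE ji) eqxx.
  transitivity ((c (V w) ^+ 2 + s (V w) ^+ 2) * (X j0 w ^+ 2 + X i w ^+ 2))%R; first by ring.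
  by rewrite cs mul1r.
Qed.

End definition.
End independent_normals.

(* An alias of the function type, to attach the pointed structure which
   [g_sigma_algebraType] requires. *)
Definition realfamily (R : realType) (I : Type) := I -> R.

HB.instance Definition _ (R : realType) (I : Type) := gen_eqMixin (realfamily R I).
HB.instance Definition _ (R : realType) (I : Type) := gen_choiceMixin (realfamily R I).
HB.instance Definition _ (R : realType) (I : Type) :=
  isPointed.Build (realfamily R I) (fun=> 0).

(** * Coordinates as a conditioning variable, and transfer between probability spaces *)

Section coordinates.
Context {R : realType} {I : choiceType}.
Local Notation g := (@gauss R).
Local Open Scope ereal_scope.

(** Only coordinates in [D] generate the sigma-algebra, since measurability of the variables is
    known on [D] alone. A point of the space is still a full family. *)
Definition cylinders (D : set I) : set (set (realfamily R I)) :=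
  [set A | exists s B, [/\ uniq s, (forall i, i \in s -> D i),
    (forall i, measurable (B i)) & A = box (fun i (z : realfamily R I) => z i) s B]].

Local Notation coordinates D := (g_sigma_algebraType (cylinders D)).

Lemma cylindersI D : setI_closed (cylinders D).
Proof.
move=> _ _ [s [B [us sD mB ->]]] [t [C [ut tD mC ->]]].
exists (undup (s ++ t)), (fun k => (if k \in s then B k else setT) `&`
                              (if k \in t then C k else setT)).
split; first exact: undup_uniq.
- by move=> i; rewrite mem_undup mem_cat => /orP[/sD|/tD].
- by move=> i; apply: measurableI; case: ifP.
apply/seteqP; split => z /=.
  by move=> [hs ht] k _; (split; case: ifPn => //); [exact: hs|exact: ht].
move=> h; split => k kst; have := h k; rewrite mem_undup mem_cat kst ?orbT => /(_ isT) [];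
  by rewrite ?kst.
Qed.

Lemma cylindersT D : cylinders D setT.
Proof. by exists [::], (fun=> setT); split => //; rewrite box_nil. Qed.

Lemma measurable_coordinate (D : set I) i : D i ->
  measurable_fun setT (fun z : coordinates D => z i).
Proof.
move=> Di _ B mB; rewrite setTI; apply: sub_sigma_algebra.
exists [:: i], (fun=> B); split => //; first by move=> k; rewrite inE => /eqP->.
by rewrite box_cons box_nil setIT.
Qed.

Section law.
Context d e (T : measurableType d) (E : measurableType e) (P : probability T R).

Definition coordinate_map (D : set I) (X : I -> T -> R) : T -> coordinates D :=
  fun w i => X i w.

Lemma measurable_coordinate_map D X : (forall i, D i -> measurable_fun setT (X i)) ->
  measurable_fun setT (coordinate_map D X).
Proof.
move=> mX; apply: (@measurability _ _ _ (coordinates D) _ _ (cylinders D)) => //.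
move=> _ [_ [s [B [us sD mB ->]]] <-]; rewrite setTI.
rewrite (_ : _ @^-1` _ = box X s B)//.
by apply: measurable_box => // i /sD; exact: mX.
Qed.

(** This allows later angles to depend on part of the normals themselves. For a fixed box over [D2]
    both sides are finite measures in [A]; on a cylinder over [D1] they agree because the two index
    lists are disjoint and concatenate to one box. *)
Lemma indep_normal_absorb (V : T -> E) D D1 D2 X : indep_normal P V D X ->
  D1 `<=` D -> D2 `<=` D -> (forall i, D1 i -> ~ D2 i) ->
  indep_normal P (coordinate_map D1 X) D2 X.
Proof.
move=> [mV mX indX] D1D D2D D12.
have indT s B : uniq s -> (forall i, i \in s -> D i) -> (forall i, measurable (B i)) ->
    P (box X s B) = \prod_(i <- s) g (B i).
  move=> us sD mB; have := indX setT s B measurableT us sD mB.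
  by rewrite preimage_setT setTI probability_setT mul1e.
have mV1 : measurable_fun setT (coordinate_map D1 X).
  by apply: measurable_coordinate_map => i /D1D; exact: mX.
split=> [//|i /D2D|A s B mA us sD mB]; first exact: mX.
have mbox : measurable (box X s B).
  by apply: measurable_box => // i /sD /D2D; exact: mX.
have p0 : (0 <= fine (P (box X s B)))%R by rewrite fine_ge0.
have pE : P (box X s B) = (NngNum p0)%:num%:E by rewrite /= fineK// fin_num_measure.
rewrite -indT//; last by move=> i /sD; exact: D2D.
rewrite muleC pE.
pose m1 : {measure set (coordinates D1) -> \bar R} :=
  pushforward_measure (mrestr P mbox) mV1.
pose m2 : {measure set (coordinates D1) -> \bar R} :=
  mscale (NngNum p0) (pushforward_measure P mV1).
have -> : P (coordinate_map D1 X @^-1` A `&` box X s B) = m1 A by [].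
have -> : (NngNum p0)%:num%:E * P (coordinate_map D1 X @^-1` A) = m2 A by [].
move: A mA; apply: (@pi_system_measure_unique _ _ (coordinates D1) (cylinders D1)) => //.
- exact: cylindersI.
- exact: cylindersT.
- rewrite -ge0_fin_numE//; apply: (fin_num_measure P); apply: measurableI => //.
  exact: (measurable_preimage _ _ _ _ _ _ mV1).
move=> _ [t [C [ut tD mC ->]]].
have -> : m1 (box (fun i (z : realfamily R I) => z i) t C) = P (box X t C `&` box X s B) by [].
have -> : m2 (box (fun i (z : realfamily R I) => z i) t C) = P (box X s B) * P (box X t C).
  by rewrite pE.
have st i : i \in s -> i \notin t by move=> /sD Di; apply/negP => /tD /D12.
pose BC i := if i \in t then C i else B i.
have -> : box X t C `&` box X s B = box X (t ++ s) BC.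
  apply/seteqP; split => w.
    move=> [ht hs] k; rewrite mem_cat /BC; case: ifPn => [kt _|_ /= ks]; [exact: ht|exact: hs].
  move=> h; split => k kst; have := h k; rewrite mem_cat kst ?orbT /BC => /(_ isT).
    by rewrite kst.
  by rewrite (negbTE (st k kst)).
have uts : uniq (t ++ s) by rewrite cat_uniq ut us andbT/=; apply/hasPn => i /st.
have tsD i : i \in t ++ s -> D i by rewrite mem_cat => /orP[/tD/D1D|/sD/D2D].
have mBC i : measurable (BC i) by rewrite /BC; case: ifP.
rewrite (indT _ BC uts tsD mBC) (indT _ C ut (fun i it => D1D _ (tD i it)) mC).
rewrite (indT _ B us (fun i is_ => D2D _ (sD i is_)) mB).
rewrite big_cat/= muleC; congr (_ * _); apply: eq_big_seq => k kst; rewrite /BC.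
  by rewrite (negbTE (st k kst)).
by rewrite kst.
Qed.

(** The pair has a product law, and by Fubini a set with null sections is null. *)
Lemma indep_normal_pair_null (V : T -> E) (D : set I) X j (W : set (E * R)%type) :
  indep_normal P V D X -> D j -> measurable W ->
  (forall v, g (xsection W v) = 0) -> P [set w | W (V w, X j w)] = 0.
Proof.
move=> [mV mX indX] Dj mW W0.
have mVX : measurable_fun setT (fun w => (V w, X j w)).
  by apply: measurable_fun_pair => //; exact: mX.
transitivity ((pushforward_measure P mV \x g) W); last first.
  by apply: integral0_eq => v _; exact: W0.
move: W mW {W0}; apply: (product_measure_ext (pushforward_measure P mVX)
  (pushforward_measure P mV \x g : {measure set (E * R)%type -> \bar R})).
  by rewrite -ge0_fin_numE//; apply: (fin_num_measure P); exact: measurable_preimage mVX _.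
move=> A B mA mB; transitivity (P (V @^-1` A) * g B); last first.
  by apply/esym; exact: product_measure1E.
have := indX A [:: j] (fun=> B) mA isT _ (fun=> mB).
by rewrite big_seq1 box_cons box_nil setIT => <- // i; rewrite inE => /eqP->.
Qed.

End law.

(** This makes the observed and the simulated triangle comparable although they live on different
    spaces: on cylinders both laws give the same product of Gaussian masses. *)
Lemma coordinate_map_law d1 d2 (T1 : measurableType d1) (T2 : measurableType d2)
    (P1 : probability T1 R) (P2 : probability T2 R) e1 e2
    (E1 : measurableType e1) (E2 : measurableType e2)
    (V1 : T1 -> E1) (V2 : T2 -> E2) (D D1 : set I) X1 X2 A :
  indep_normal P1 V1 D X1 -> indep_normal P2 V2 D X2 -> D1 `<=` D ->
  measurable A -> P1 (coordinate_map D1 X1 @^-1` A) = P2 (coordinate_map D1 X2 @^-1` A).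
Proof.
move=> ind1 ind2 D1D.
have mV1 : measurable_fun setT (coordinate_map D1 X1).
  by apply: measurable_coordinate_map => i /D1D; case: ind1 => _ mX _; exact: mX.
have mV2 : measurable_fun setT (coordinate_map D1 X2).
  by apply: measurable_coordinate_map => i /D1D; case: ind2 => _ mX _; exact: mX.
move: A; apply: (@pi_system_measure_unique _ _ (coordinates D1) (cylinders D1)
  (pushforward_measure P1 mV1) (pushforward_measure P2 mV2)) => //.
- exact: cylindersI.
- exact: cylindersT.
- by rewrite -ge0_fin_numE//; apply: (fin_num_measure P1); exact: (measurable_preimage _ _ _ _ _ _ mV1).
move=> _ [t [C [ut tD mC ->]]].
have tD' i : i \in t -> D i by move=> /tD /D1D.
have [_ _ /(_ setT t C measurableT ut tD' mC)] := ind1.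
have [_ _ /(_ setT t C measurableT ut tD' mC)] := ind2.
by rewrite !preimage_setT !setTI !probability_setT !mul1e /= /pushforward => <-.
Qed.

Lemma indep_normal_pair_law d1 d2 (T1 : measurableType d1) (T2 : measurableType d2)
    (P1 : probability T1 R) (P2 : probability T2 R) e (E : measurableType e)
    (V1 : T1 -> E) (V2 : T2 -> E) (D : set I) j X1 X2 (W : set (E * R)%type) :
  indep_normal P1 V1 D X1 -> indep_normal P2 V2 D X2 -> D j ->
  (forall A, measurable A -> P1 (V1 @^-1` A) = P2 (V2 @^-1` A)) ->
  measurable W -> P1 [set w | W (V1 w, X1 j w)] = P2 [set w | W (V2 w, X2 j w)].
Proof.
move=> [mV1 mX1 ind1] [mV2 mX2 ind2] Dj V12.
have mVX1 : measurable_fun setT (fun w => (V1 w, X1 j w)).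
  by apply: measurable_fun_pair => //; exact: mX1.
have mVX2 : measurable_fun setT (fun w => (V2 w, X2 j w)).
  by apply: measurable_fun_pair => //; exact: mX2.
move: W; apply: (product_measure_ext (pushforward_measure P1 mVX1)
  (pushforward_measure P2 mVX2)).
  by rewrite -ge0_fin_numE//; apply: (fin_num_measure P1); exact: measurable_preimage mVX1 _.
move=> A B mA mB.
have jD i : i \in [:: j] -> D i by rewrite inE => /eqP->.
have := ind1 A [:: j] (fun=> B) mA isT jD (fun=> mB).
have := ind2 A [:: j] (fun=> B) mA isT jD (fun=> mB).
by rewrite !box_cons !box_nil !setIT (V12 _ mA) /= /pushforward => <-.
Qed.

End coordinates.

(** The constant conditioning variable is the starting point; rotations relative to it have constant
    angles. *)
Lemma indep_normal_iid (R : realType) d (T : measurableType d) (P : probability T R)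
    (I : choiceType) (D : set I) (X : I -> T -> R) :
  iid_std_normal P D X -> indep_normal P (fun=> tt) D X.
Proof.
move=> [nX indX]; split => [|i /nX[]//|A s B mA us sD mB]; first exact: measurable_cst.
have PB : (P (box X s B) = \prod_(i <- s) gauss (B i))%E.
  transitivity (\prod_(i <- s) P (X i @^-1` B i))%E.
    rewrite -(indX s B us (fun i is_ => conj (sD i is_) (mB i))).
    by congr (P _); apply/seteqP; split => w h i /=; exact: h.
  by apply: eq_big_seq => i /sD /nX[_]; apply.
have [Att|Att] := pselect (A tt).
  rewrite (_ : _ @^-1` A = setT); last by apply/seteqP; split.
  by rewrite setTI probability_setT mul1e.
rewrite (_ : _ @^-1` A = set0); last by apply/seteqP; split.
by rewrite set0I measure0 mul0e.
Qed.

(** * Quantiles of real random variables *)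

Section quantiles.
Context {R : realType} d (T : measurableType d) (P : probability T R).
Implicit Types (Y : T -> R) (alpha : R).

Lemma ae_measure_eq (A B : set T) : measurable A -> measurable B ->
  {ae P, forall w, A w <-> B w} -> P A = P B.
Proof.
move=> mA mB [N [mN N0 subN]].
have NAB w : ~ N w -> (A w <-> B w).
  by move=> Nw; apply: contrapT => AB; apply: Nw; exact: subN.
rewrite -(measureU0 mA mN N0) -(measureU0 mB mN N0); congr (P _).
by apply/seteqP; split => w [ABw|Nw]; try (by right);
  have [Nw|/NAB[AB BA]] := pselect (N w); [by right|left; exact: AB|by right|left; exact: BA].
Qed.

(** Continuity from below in the one form that the quantile arguments need; limits of decreasing
    events are handled through complements [x < Y w]. *)
Lemma measure_bigcup_le (b : \bar R) (F : (set T)^nat) :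
  (forall n, measurable (F n)) -> nondecreasing_seq F -> (forall n, P (F n) <= b)%E ->
  (P (\bigcup_n F n) <= b)%E.
Proof.
move=> mF ndF Fb.
have cvF := @nondecreasing_cvg_mu _ _ _ P F mF (bigcupT_measurable F mF) ndF.
rewrite -(cvg_lim _ cvF)//; apply: lime_le; first by apply/cvg_ex; eexists; exact: cvF.
by apply: nearW => n; exact: Fb.
Qed.

Lemma measurable_le_set Y x : measurable_fun setT Y -> measurable [set w | Y w <= x].
Proof.
move=> mY; rewrite (_ : [set w | _] = Y @^-1` `]-oo, x]).
  by apply: measurable_preimage => //; exact: measurable_itv.
by apply/seteqP; split => w /=; rewrite in_itv.
Qed.

Lemma measurable_gt_set Y x : measurable_fun setT Y -> measurable [set w | x < Y w].
Proof.
move=> mY; rewrite (_ : [set w | _] = Y @^-1` `]x, +oo[).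
  by apply: measurable_preimage => //; exact: measurable_itv.
by apply/seteqP; split => w /=; rewrite in_itv/= andbT.
Qed.

Lemma prob_gtE Y x : measurable_fun setT Y ->
  P [set w | x < Y w] = (1 - P [set w | (Y w <= x)%R])%E.
Proof.
move=> mY; rewrite -probability_setC; last exact: measurable_le_set.
by congr (P _); apply/seteqP; split => w /=; rewrite ltNge => /negP.
Qed.

Lemma prob_le_mono Y x y : measurable_fun setT Y -> x <= y ->
  (P [set w | (Y w <= x)%R] <= P [set w | (Y w <= y)%R])%E.
Proof.
move=> mY xy; apply: le_measure; rewrite ?inE; try exact: measurable_le_set.
by move=> w /= /le_trans; apply.
Qed.

(** The distribution function tends to 1 > alpha and to 0 < alpha at the two ends, so the infimum
    defining [quantile] is a genuine one. *)
Lemma has_inf_quantile Y alpha : measurable_fun setT Y -> 0 < alpha < 1 ->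
  has_inf [set x : R | (alpha%:E <= P [set w | (Y w <= x)%R])%E].
Proof.
move=> mY /andP[a0 a1]; split.
- apply: contrapT => noA.
  have F n : (P [set w | (Y w <= n%:R)%R] <= alpha%:E)%E.
    by apply/ltW; rewrite ltNge; apply/negP => h; apply: noA; exists n%:R.
  have : (P (\bigcup_n [set w | (Y w <= n%:R)%R]) <= alpha%:E)%E.
    apply: measure_bigcup_le => //; first by move=> n; exact: measurable_le_set.
    by move=> m n mn; apply/subsetPset => w /= /le_trans; apply; rewrite ler_nat.
  rewrite (_ : \bigcup_n _ = setT) ?probability_setT ?lee_fin ?leNgt ?a1//.
  apply/seteqP; split => // w _.
  exists (Num.bound `|Y w|) => //=; apply/ltW/(le_lt_trans (ler_norm _)).
  exact: archi_boundP.
- apply: contrapT => noB.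
  have F n : (P [set w | (- n%:R < Y w)%R] <= (1 - alpha)%:E)%E.
    rewrite prob_gtE//.
    have : ~ lbound [set x : R | (alpha%:E <= P [set w | (Y w <= x)%R])%E] (- n%:R).
      by move=> h; apply: noB; exists (- n%:R).
    move=> /existsNP[x /not_implyP[/= ax /negP]]; rewrite -ltNge => xn.
    have := le_trans ax (prob_le_mono mY (ltW xn)).
    rewrite -(@fineK _ (P _)) ?fin_num_measure//; last exact: measurable_le_set.
    by rewrite -EFinB !lee_fin; lra.
  have : (P (\bigcup_n [set w | (- n%:R < Y w)%R]) <= (1 - alpha)%:E)%E.
    apply: measure_bigcup_le => //; first by move=> n; exact: measurable_gt_set.
    move=> m n mn; apply/subsetPset => w /=; apply: le_lt_trans.
    by rewrite lerN2 ler_nat.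
  rewrite (_ : \bigcup_n _ = setT) ?probability_setT ?lee_fin; first lra.
  apply/seteqP; split => // w _.
  exists (Num.bound `|Y w|) => //=; rewrite ltrNl.
  by apply/(le_lt_trans (ler_norm _)); rewrite normrN; exact: archi_boundP.
Qed.

(** Below q every value of the distribution function is less than alpha, and the absence of an atom
    carries this bound to q itself; the reverse inequality is right continuity. *)
Lemma quantile_prob Y alpha : measurable_fun setT Y -> 0 < alpha < 1 ->
  (forall x, P [set w | Y w = x] = 0)%E ->
  P [set w | Y w <= quantile P Y alpha] = alpha%:E.
Proof.
move=> mY a01 Y0; set q := quantile P Y alpha.
have [A0 Alb] := has_inf_quantile mY a01.
apply/eqP; rewrite eq_le; apply/andP; split.
- have -> : P [set w | Y w <= q] = P [set w | Y w < q].
    have meq : measurable [set w | Y w = q].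
      by apply: (measurable_preimage _ _ _ _ Y [set q]).
    rewrite (_ : [set w | Y w <= q] = [set w | Y w < q] `|` [set w | Y w = q]); last first.
      apply/seteqP; split => w /=; first by rewrite le_eqVlt => /orP[/eqP|]; [right|left].
      by case=> [/ltW//|->].
    apply: (measureU0 _ meq (Y0 q)).
    rewrite (_ : [set w | _] = Y @^-1` `]-oo, q[).
      by apply: measurable_preimage => //; exact: measurable_itv.
    by apply/seteqP; split => w /=; rewrite in_itv.
  rewrite (_ : [set w | _] = \bigcup_n [set w | Y w <= q - n.+1%:R^-1]); last first.
    apply/seteqP; split => w /=.
      by move=> /ltr_add_invr[n nq]; exists n => //=; rewrite lerBrDr ltW.
    by move=> [n _ /= /le_lt_trans]; apply; rewrite ltrBlDr ltrDl invr_gt0.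
  apply: measure_bigcup_le.
  + by move=> n; exact: measurable_le_set.
  + move=> m n mn; apply/subsetPset => w /= /le_trans; apply.
    by rewrite lerD2l lerN2 lef_pV2 ?posrE ?ler_nat.
  + move=> n; apply/ltW; rewrite ltNge; apply/negP => h.
    have : q <= q - n.+1%:R^-1 by apply: ge_inf.
    by rewrite leNgt ltrBlDr ltrDl invr_gt0 ltr0n.
- suff : (P [set w | (q < Y w)%R] <= (1 - alpha)%:E)%E.
    rewrite prob_gtE// -(@fineK _ (P [set w | Y w <= q])) ?fin_num_measure//; last first.
      exact: measurable_le_set.
    by rewrite -EFinB !lee_fin; lra.
  rewrite (_ : [set w | _] = \bigcup_n [set w | q + n.+1%:R^-1 < Y w]); last first.
    apply/seteqP; split => w /=.
      by move=> /ltr_add_invr[n nq]; exists n.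
    by move=> [n _ /=]; apply: le_lt_trans; rewrite lerDl invr_ge0.
  apply: measure_bigcup_le.
  + by move=> n; exact: measurable_gt_set.
  + move=> m n mn; apply/subsetPset => w /=; apply: le_lt_trans.
    by rewrite lerD2l lef_pV2 ?posrE ?ler_nat.
  + move=> n; rewrite prob_gtE//.
    have e0 : 0 < n.+1%:R^-1 :> R by rewrite invr_gt0.
    have [x Ax xq] := inf_adherent e0 (conj A0 Alb).
    have := le_trans Ax (prob_le_mono mY (ltW xq)).
    rewrite -(@fineK _ (P _)) ?fin_num_measure//; last exact: measurable_le_set.
    by rewrite -EFinB !lee_fin; lra.
Qed.

Lemma quantile_affine Y alpha m s : measurable_fun setT Y -> 0 < alpha < 1 -> 0 < s ->
  quantile P (fun w => m + s * Y w) alpha = m + s * quantile P Y alpha.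
Proof.
move=> mY a01 s0.
have mY' : measurable_fun setT (fun w => m + s * Y w).
  by apply: measurable_funD => //; exact: measurable_funM.
have [A0 Alb] := has_inf_quantile mY a01.
have [A'0 A'lb] := has_inf_quantile mY' a01.
have PE x : P [set w | m + s * Y w <= x] = P [set w | Y w <= (x - m) / s].
  by congr (P _); apply/seteqP; split => w /=; rewrite ler_pdivlMr// lerBrDl mulrC.
apply/eqP; rewrite eq_le; apply/andP; split.
- rewrite -lerBlDl -ler_pdivrMl//; apply: lb_le_inf => // x Ax.
  rewrite ler_pdivrMl// lerBlDl; apply: ge_inf => //=.
  by rewrite PE addrAC subrr add0r mulrAC divff ?mul1r// gt_eqF.
- apply: lb_le_inf => // x; rewrite /= PE => Ax.
  by rewrite -lerBrDl -ler_pdivlMl// mulrC; exact: ge_inf.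
Qed.

Lemma quantile_cst m alpha : 0 < alpha < 1 -> quantile P (fun=> m) alpha = m.
Proof.
move=> /andP[a0 a1]; rewrite /quantile (_ : [set x | _] = `[m, +oo[%classic).
  by rewrite inf_itv.
apply/seteqP; split => x /=; rewrite in_itv/= andbT; last first.
  move=> mx; rewrite (_ : [set w | _] = setT) ?probability_setT ?lee_fin ?(ltW a1)//.
  by apply/seteqP; split.
move=> aP; rewrite leNgt; apply/negP => xm; move: aP.
have -> : [set w : T | m <= x] = set0.
  by apply/seteqP; split => // w; rewrite /= leNgt xm.
by rewrite measure0 lee_fin leNgt a0.
Qed.

End quantiles.

(** * Algebraic identities for the chain-ladder estimators *)

Section chain_ladder_identities.
Context {R : realType} (n gamma : nat) (C : nat -> nat -> R) (f sigma : nat -> R).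
Hypothesis C_gt0 : forall i k, (i + k <= n)%N -> 0 < C i k.
Implicit Types (z : nat * nat -> R) (i k : nat).

Local Notation Cg := (Cg gamma C).
Local Notation Rp := (Rp n gamma C).
Local Notation Mp := (Mp n gamma C).
Local Notation vv := (vv n gamma C).

Definition colweight k : R := \sum_(0 <= h < (n - k)%N.+1) Cg h k.-1.

Lemma Cg_gt0 i k : (i + k <= n)%N -> 0 < Cg i k.
Proof. by move=> ik; rewrite exprn_gt0// C_gt0. Qed.

Lemma Cg_col_gt0 i k : (1 <= k <= n)%N -> (i <= n - k)%N -> 0 < Cg i k.-1.
Proof. by move=> k1 ik; apply: Cg_gt0; lia. Qed.

Lemma colweight_gt0 k : (1 <= k <= n)%N -> 0 < colweight k.
Proof.
move=> k1; rewrite /colweight big_nat_recl//; apply: ltr_wpDr.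
  by rewrite big_nat sumr_ge0// => i ik; apply/ltW/Cg_col_gt0 => //; lia.
exact: Cg_col_gt0.
Qed.

(** Exhibits [Rp] as an inner product with the vector of square roots of the weights, whose squared
    length is [colweight k]. *)
Lemma RpE z k : Rp z k =
  (\sum_(0 <= i < (n - k)%N.+1) Num.sqrt (Cg i k.-1) * z (i, k)) / colweight k.
Proof. by rewrite mulr_suml; apply: eq_bigr => i _; rewrite [z _ * _]mulrC. Qed.

Lemma fhatE z k : (1 <= k <= n.-1)%N -> (2 <= n)%N ->
  fhat n gamma C f sigma z k = f k + sigma k * Rp z k.
Proof.
move=> k1 n2; have kn : (1 <= k <= n)%N by lia.
have W0 : colweight k != 0 by rewrite gt_eqF// colweight_gt0.
rewrite /fhat ifF; last by apply/eqP; lia.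
rewrite RpE -/(colweight k) mulrA -[f k](mulfK W0) -mulrDl; congr (_ / _).
rewrite /colweight !mulr_sumr -big_split/=; apply: eq_big_nat => i ik.
have c0 : 0 < Cg i k.-1 by apply: Cg_col_gt0 => //; lia.
rewrite /Fobs /Cmh -/(Cg i k.-1).
have a2 : Cg i k.-1 = Num.sqrt (Cg i k.-1) ^+ 2 by rewrite sqr_sqrtr ?ltW.
have a0 : Num.sqrt (Cg i k.-1) != 0 by rewrite gt_eqF// sqrtr_gt0.
set a := Num.sqrt _ in a2 a0 *; rewrite a2; by field.
Qed.

Lemma sigmahat2E z k : (1 <= k <= n.-1)%N -> (2 <= n)%N ->
  sigmahat2 n gamma C f sigma z k = sigma k ^+ 2 * Mp z k.
Proof.
move=> k1 n2; rewrite /sigmahat2 ifF; last by apply/eqP; lia.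
rewrite fhatE// /Mp mulrCA; congr (_ * _).
rewrite [RHS]mulr_sumr; apply: eq_bigr => i _; rewrite /Fobs /Cmh -/(Cg i k.-1); ring.
Qed.

(** Pythagoras: the squared length of the column minus that of its projection on the vector of
    square roots of the weights. *)
Lemma MpE z k : (1 <= k <= n)%N ->
  Mp z k = ((n - k)%N%:R)^-1 *
    (\sum_(0 <= i < (n - k)%N.+1) z (i, k) ^+ 2 - colweight k * Rp z k ^+ 2).
Proof.
move=> k1; rewrite /Mp; congr (_ * _).
have W0 : colweight k != 0 by rewrite gt_eqF// colweight_gt0.
set r := Rp z k.
have rE : \sum_(0 <= i < (n - k)%N.+1) Num.sqrt (Cg i k.-1) * z (i, k) = r * colweight k.
  by rewrite /r RpE divfK.
transitivity (\sum_(0 <= i < (n - k)%N.+1)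
    (z (i, k) ^+ 2 - (2 * r) * (Num.sqrt (Cg i k.-1) * z (i, k)) + r ^+ 2 * Cg i k.-1)).
  apply: eq_big_nat => i ik.
  have c0 : 0 < Cg i k.-1 by apply: Cg_col_gt0 => //; lia.
  have a2 : Cg i k.-1 = Num.sqrt (Cg i k.-1) ^+ 2 by rewrite sqr_sqrtr ?ltW.
  have a0 : Num.sqrt (Cg i k.-1) != 0 by rewrite gt_eqF// sqrtr_gt0.
  set a := Num.sqrt _ in a2 a0 *; rewrite a2; by field.
rewrite big_split sumrB/= -!mulr_sumr rE -/(colweight k); ring.
Qed.

Definition colshock z i : R :=
  (Cmh gamma C i (n - i)%N * z (i, (n - i + 1)%N) - Rp z (n - i + 1)%N) * C i (n - i)%N.

Lemma vv_gt0 i : (2 <= i <= n)%N -> 0 < vv i.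
Proof.
move=> i2; rewrite /vv mulr_gt0// ?exprn_gt0 ?C_gt0 ?addr_gt0// ?invr_gt0; try lia.
  by apply: Cg_gt0; lia.
rewrite big_ltn; last by lia.
apply: ltr_wpDr; last by apply: Cg_gt0; lia.
by rewrite big_nat sumr_ge0// => l li; apply/ltW/Cg_gt0; lia.
Qed.

(** Shows v_i as the squared length of the coefficient vector of [colshock] in two orthonormal
    coordinates: the next residue and the normalized weighted mean of the column. *)
Lemma vvE i : (2 <= i <= n)%N ->
  vv i = (Cmh gamma C i (n - i)%N * C i (n - i)%N) ^+ 2 +
    (- (C i (n - i)%N / Num.sqrt (colweight (n - i + 1)%N))) ^+ 2.
Proof.
move=> i2; rewrite /vv /colweight.
rewrite (_ : (n - (n - i + 1)).+1 = i)%N; last by lia.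
rewrite (_ : (n - i + 1).-1 = n - i)%N; last by lia.
rewrite sqrrN exprMn expr_div_n /Cmh -/(Cg i (n - i)%N) exprVn !sqr_sqrtr.
- by rewrite mulrDr mulrC.
- by rewrite big_nat sumr_ge0// => l li; apply/ltW/Cg_gt0; lia.
- by apply/ltW/Cg_gt0; lia.
Qed.

End chain_ladder_identities.

(** * Orthogonal change of coordinates in the triangle *)

Section payment_shocks.
Context {R : realType} (n gamma : nat) (C : nat -> nat -> R).
Hypothesis C_gt0 : forall i k, (i + k <= n)%N -> 0 < C i k.
Context d e (T : measurableType d) (E : measurableType e) (P : probability T R).
Variable V : T -> E.

Local Notation I := (nat * nat)%type.
Local Notation Cg := (Cg gamma C).
Local Notation colshock := (colshock n gamma C).
Local Notation vv := (vv n gamma C).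
Local Notation colweight := (colweight n gamma C).
Local Notation indep := (indep_normal P V (all_idx n)).

(* After the change of coordinates in column [n - i + 1] the row [0] carries the weighted
   mean, the rows [1 .. i - 1] the empirical variance and the row [i] the shock of the next
   payment, whose observation is not part of the triangle. *)
Definition colM (z : I -> R) i : R :=
  (i.-1%:R)^-1 * \sum_(1 <= l < i) z (l, (n - i + 1)%N) ^+ 2.

Definition normalized (X X' : I -> T -> R) i :=
  forall w, let z ik := X ik w in let z' ik := X' ik w in
  colshock z i = Num.sqrt (vv i) * z' (i, (n - i + 1)%N) /\
  Mp n gamma C z (n - i + 1)%N = colM z' i.

(** Two rotations. The first collects the weighted mean of rows 0 to i - 1 in row 0; sums of squares
    being preserved, the other rows then carry [Mp] by [MpE]. The second acts in the plane of rows i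
    and 0 and puts the whole shock into row i. *)
Lemma normalize_column (X : I -> T -> R) i : indep X -> (2 <= i <= n)%N ->
  exists X', [/\ indep X', normalized X X' i &
    forall l k, k != (n - i + 1)%N -> X' (l, k) = X (l, k)].
Proof.
move=> indX i2; set c := (n - i + 1)%N.
have nc : (n - c)%N = i.-1 by rewrite /c; lia.
have cp : c.-1 = (n - i)%N by rewrite /c; lia.
have i1 : i.-1.+1 = i by lia.
have cn : (1 <= c <= n)%N by rewrite /c; lia.
pose a (ik : I) (_ : E) := Num.sqrt (Cg ik.1 c.-1).
have W0 : 0 < colweight c by exact: colweight_gt0.
have WE : colweight c = \sum_(l <- iota 0 i) Cg l c.-1.
  by rewrite /colweight nc i1 /index_iota subn0.
pose row (s : seq nat) := [seq (l, c) | l <- s].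
have rowE s (F : I -> R) : \sum_(p <- row s) F p = \sum_(l <- s) F (l, c).
  by rewrite big_map.
have i0E : iota 0 i = 0%N :: iota 1 i.-1 by rewrite -{1}i1.
have rowD p : p \in row (iota 0 i) -> all_idx n p.
  by move=> /mapP[l]; rewrite mem_iota => li ->; left; split => /=; rewrite /c; lia.
have urow : uniq (row (iota 0 i)).
  by rewrite map_inj_uniq ?iota_uniq// => l l' [].
have rowE0 : row (iota 0 i) = (0%N, c) :: row (iota 1 i.-1) by rewrite i0E.
rewrite rowE0 in rowD urow.
have [||Y [indY YX sumY sqY]] := indep_normal_combine indX urow rowD (a := a).
- by move=> p; exact: measurable_cst.
- by move=> v; exact: sqrtr_ge0.
rewrite -rowE0 in rowD urow YX sumY sqY.
have RpY w : Rp n gamma C (fun ik => X ik w) c = Y (0%N, c) w / Num.sqrt (colweight c).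
  have := sumY w; rewrite !rowE.
  have -> : \sum_(l <- iota 0 i) a (l, c) (V w) ^+ 2 = colweight c.
    rewrite WE; apply: eq_big_seq => l; rewrite mem_iota => li; rewrite /a /= sqr_sqrtr// ltW//.
    by apply: (Cg_col_gt0 gamma C_gt0 cn); rewrite nc; lia.
  rewrite RpE nc i1 /index_iota subn0 /a/= => ->.
  have W2 : colweight c = Num.sqrt (colweight c) ^+ 2 by rewrite sqr_sqrtr ?ltW.
  have s0 : Num.sqrt (colweight c) != 0 by rewrite gt_eqF// sqrtr_gt0.
  by set s := Num.sqrt _ in s0 W2 *; rewrite W2; field.
(* The coefficients of the shock as in [vvE]. Row [i] is the head of the list because its
   coefficient is nonnegative, while that of the mean is not. *)
pose b (ik : I) (_ : E) := if ik == (i, c) then Cmh gamma C i (n - i)%N * C i (n - i)%N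
  else - (C i (n - i)%N / Num.sqrt (colweight c)).
have icn : (i, c) \notin row (iota 0 i).
  by apply/negP => /mapP[l]; rewrite mem_iota => li [il]; lia.
have i0 : (i, c) != (0%N, c) by apply/eqP => -[]; lia.
have [||||X' [indX' X'Y sumX' _]] := indep_normal_combine indY
  (j0 := (i, c)) (l := [:: (0%N, c)]) (a := b).
- by rewrite /= inE i0.
- move=> p; rewrite !inE => /orP[|] /eqP ->; first by right; split=> //=; lia.
  by left; split => /=; rewrite /c; lia.
- by move=> p; rewrite /b; case: ifP => _; exact: measurable_cst.
- move=> v; rewrite /b eqxx mulr_ge0// ?invr_ge0 ?sqrtr_ge0//.
  by apply/ltW/C_gt0; lia.
exists X'; split => //; last first.
  move=> l k kc; rewrite X'Y ?YX//.
    by apply/negP => /mapP[l' _ [_ /eqP]]; rewrite (negbTE kc).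
  by rewrite !inE !xpair_eqE !negb_or (negbTE kc) !andbF.
move=> w z z'; split.
- have := sumX' w; rewrite !big_cons !big_nil !addr0 /b eqxx (eq_sym _ (i, c)) (negbTE i0).
  rewrite -vvE// => vE; rewrite -vE /colshock -/c RpY /z -(YX _ icn).
  by ring.
- rewrite MpE// nc i1 -/c /colM; congr (_ * _).
  rewrite RpY expr_div_n sqr_sqrtr ?ltW// mulrCA divff ?gt_eqF// mulr1.
  rewrite /index_iota subn0 subn1.
  have := sqY w; rewrite !rowE i0E !big_cons => sq; rewrite -sq addrC addKr.
  apply: eq_big_seq => l; rewrite mem_iota => li; rewrite /z' X'Y//.
  rewrite !inE !xpair_eqE; apply/negP => /orP[]/andP[/eqP]; lia.
Qed.

(** Only column n - i + 1 enters, so a column already normalized stays so when others are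
    rotated. *)
Lemma normalized_ext (X X' Y Y' : I -> T -> R) i :
  (forall l, X (l, n - i + 1)%N = Y (l, n - i + 1)%N) ->
  (forall l, X' (l, n - i + 1)%N = Y' (l, n - i + 1)%N) ->
  normalized X X' i -> normalized Y Y' i.
Proof.
move=> XY X'Y' H w /=; have [] := H w.
have RXY : Rp n gamma C (fun ik => X ik w) (n - i + 1) =
    Rp n gamma C (fun ik => Y ik w) (n - i + 1).
  by apply: eq_bigr => l _; rewrite XY.
rewrite /colshock /Mp /colM RXY XY X'Y' => -> ME; split => //.
transitivity (((n - (n - i + 1))%N%:R)^-1 * \sum_(0 <= l < (n - (n - i + 1))%N.+1)
  Cg l (n - i + 1).-1 * (X (l, (n - i + 1)%N) w / Num.sqrt (Cg l (n - i + 1).-1) -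
    Rp n gamma C (fun ik => Y ik w) (n - i + 1)) ^+ 2).
  by congr (_ * _); apply: eq_bigr => l _; rewrite XY.
by rewrite ME; congr (_ * _); apply: eq_bigr => l _; rewrite X'Y'.
Qed.

Lemma normalize_triangle (X : I -> T -> R) : indep X ->
  exists X', indep X' /\ forall i, (2 <= i <= n)%N -> normalized X X' i.
Proof.
move=> indX.
(* The columns are treated from right to left; the last clause records that those still to come are
   untouched. *)
suff H j : (j <= n)%N -> exists X', [/\ indep X',
    forall i, (2 <= i <= j)%N -> normalized X X' i &
    forall l k, (k < n - j + 1)%N -> X' (l, k) = X (l, k)].
  by have [X' [indX' nX' _]] := H n (leqnn n); exists X'.
elim: j => [_|j ih jn].
  by exists X; split => // i; lia.
have [X' [indX' nX' X'X]] := ih (ltnW jn).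
have [j1|j1] := leqP j.+1 1.
  by exists X'; split => // [i ij|l k kj]; [lia|apply: X'X; lia].
have [|X'' [indX'' nX'' X''X']] := normalize_column (i := j.+1) indX'; first lia.
exists X''; split => // [i ij|l k kj]; last by rewrite X''X' ?X'X//; lia.
have [ij'|ij'] := eqVneq i j.+1.
  rewrite ij'; apply: normalized_ext nX'' => // l.
  by apply: X'X; lia.
apply: normalized_ext (nX' i _) => //; last lia.
by move=> l; rewrite X''X'//; lia.
Qed.

End payment_shocks.

(** * Decomposition of true and modelled payments, and the studentized statistic *)

Section model.
Context {R : realType} (n gamma : nat) (C : nat -> nat -> R) (f sigma : nat -> R).
Hypothesis n2 : (2 <= n)%N.
Hypothesis C_gt0 : forall i k, (i + k <= n)%N -> 0 < C i k.
Hypothesis sigma_gt0 : forall k, (1 <= k <= n.-1)%N -> 0 < sigma k.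
Hypothesis (fn1 : f n = 1) (sigman0 : sigma n = 0).

Local Notation I := (nat * nat)%type.
Local Notation colshock := (colshock n gamma C).
Local Notation vv := (vv n gamma C).
Local Notation ww := (ww n gamma C sigma).
Local Notation colM := (colM n).
Local Notation Mp := (Mp n gamma C).
Local Notation fhat := (fhat n gamma C f sigma).
Local Notation sigmahat2 := (sigmahat2 n gamma C f sigma).
Local Notation sigsim := (sigsim n gamma C f sigma).
Local Notation Zhat := (Zhat n gamma C f sigma).
Local Notation asim := (asim n gamma C f sigma).
Implicit Types z : I -> R.

(** The estimated variance of the prediction error; [payvar] is its true counterpart. *)
Definition totvar z : R := \sum_(2 <= i < n.+1) sigmahat2 z (n - i + 1)%N * vv i.

Definition payvar : R := \sum_(2 <= i < n.+1) sigma (n - i + 1)%N ^+ 2 * vv i.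

(** Accident year 1 meets column n, where there is no noise, so its term drops out of every
    deviation. *)
Let sum_first (F : nat -> R) : F 1%N = 0 ->
  \sum_(1 <= i < n.+1) F i = \sum_(2 <= i < n.+1) F i.
Proof. by move=> F1; rewrite big_ltn ?F1 ?add0r//; lia. Qed.

Let n11 : (n - 1 + 1)%N = n. Proof. lia. Qed.

Lemma payvar_gt0 : 0 < payvar.
Proof.
rewrite /payvar big_ltn; last lia.
apply: ltr_wpDr; last first.
  by rewrite mulr_gt0 ?exprn_gt0 ?sigma_gt0 ?vv_gt0//; lia.
rewrite big_nat sumr_ge0// => i i2; rewrite mulr_ge0 ?sqr_ge0//.
by apply/ltW/vv_gt0 => //; lia.
Qed.

Lemma Ztrue_decomp z : Ztrue n gamma C f sigma z =
  \sum_(1 <= i < n.+1) Zhat z i +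
  \sum_(2 <= i < n.+1) sigma (n - i + 1)%N * colshock z i.
Proof.
apply/eqP; rewrite -subr_eq0 opprD addrA subr_eq0 -sumrB; apply/eqP.
rewrite sum_first; last first.
  by rewrite /Zhat /fhat n11 eqxx fn1 sigman0; ring.
apply: eq_big_nat => i i2; rewrite /Zhat fhatE//; last lia.
rewrite /colshock; ring.
Qed.

Lemma Zadj_decomp z z' : Zadj n gamma C f sigma z z' =
  \sum_(1 <= i < n.+1) Zhat z i +
  asim z z' * \sum_(2 <= i < n.+1) sigsim z z' (n - i + 1)%N * colshock z' i.
Proof.
apply/eqP; rewrite addrC -subr_eq -sumrB; apply/eqP.
rewrite sum_first; last first.
  by rewrite /Zmodel /Zhat /fhat /fsim /sigsim n11 eqxx; ring.
rewrite mulr_sumr; apply: eq_big_nat => i i2.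
rewrite /Zmodel /Zhat /fsim ifF; last by apply/eqP; lia.
rewrite /colshock; ring.
Qed.

Lemma Mp_ge0 z k : (1 <= k <= n)%N -> 0 <= Mp z k.
Proof.
move=> k1; rewrite /Mp mulr_ge0 ?invr_ge0// big_nat sumr_ge0// => i ik.
rewrite mulr_ge0 ?sqr_ge0//; apply/ltW/(Cg_col_gt0 gamma C_gt0 k1); lia.
Qed.

Lemma sigmahat2_ge0 z k : (1 <= k <= n.-1)%N -> 0 <= sigmahat2 z k.
Proof. by move=> k1; rewrite sigmahat2E// mulr_ge0 ?sqr_ge0// Mp_ge0//; lia. Qed.

Lemma totvarE z : totvar z = payvar * \sum_(2 <= i < n.+1) ww i * Mp z (n - i + 1)%N.
Proof.
rewrite /totvar mulr_sumr; apply: eq_big_nat => i i2.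
rewrite sigmahat2E//; last lia.
by rewrite /ww -/payvar; field; rewrite gt_eqF// payvar_gt0.
Qed.

Lemma totvar_ge0 z : 0 <= totvar z.
Proof.
rewrite /totvar big_nat sumr_ge0// => i i2.
by rewrite mulr_ge0 ?sigmahat2_ge0//; [lia|apply/ltW/vv_gt0 => //; lia].
Qed.

(* The correction factor is chosen so that the conditional standard deviation of
   the model does not depend on how the estimated variances spread over columns. *)
Lemma asim_sqrt z z' : 0 < totvar z ->
  (forall i, (2 <= i <= n)%N -> 0 < Mp z' (n - i + 1)%N) ->
  asim z z' * Num.sqrt (\sum_(2 <= i < n.+1) sigsim z z' (n - i + 1)%N ^+ 2 * vv i) =
  Num.sqrt (totvar z) * (Num.sqrt (\sum_(2 <= i < n.+1) ww i * Mp z' (n - i + 1)%N))^-1.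
Proof.
move=> Sz M0; rewrite /asim.
set A := \sum_(2 <= i < n.+1) _ * vv i.
set B := \sum_(2 <= i < n.+1) ww i * _.
have AE : A = \sum_(2 <= i < n.+1) sigmahat2 z (n - i + 1)%N * vv i / Mp z' (n - i + 1)%N.
  apply: eq_big_nat => i i2; rewrite /sigsim ifF; last by apply/eqP; lia.
  rewrite sqr_sqrtr; first by rewrite mulrAC.
  by rewrite divr_ge0 ?sigmahat2_ge0 ?Mp_ge0//; lia.
have -> : \sum_(2 <= i < n.+1) wwhat n gamma C f sigma z i / Mp z' (n - i + 1)%N = A / totvar z.
  rewrite AE mulr_suml; apply: eq_big_nat => i i2.
  by rewrite /wwhat -/(totvar z) mulrAC.
(* A sum of nonnegative terms: if it vanished, every [sigmahat2] * v_i would, contradicting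
   [0 < totvar z]. *)
have A0 : 0 < A.
  have term0 i : (2 <= i <= n)%N ->
      0 <= sigmahat2 z (n - i + 1)%N * vv i / Mp z' (n - i + 1)%N.
    move=> i2; apply: divr_ge0.
      apply: mulr_ge0; last exact: ltW (vv_gt0 gamma C_gt0 i2).
      by apply: sigmahat2_ge0; lia.
    by apply: Mp_ge0; lia.
  have A0 : 0 <= A by rewrite AE big_nat sumr_ge0// => i i2; apply: term0; lia.
  rewrite lt_neqAle A0 andbT eq_sym; apply: contraTneq Sz => A00.
  rewrite -leNgt /totvar big_nat big1// => i i2.
  have i2' : (2 <= i <= n)%N by lia.
  move: A00; rewrite AE big_nat => /eqP.
  rewrite psumr_eq0; last by move=> k k2; apply: term0; lia.
  move=> /allP /(_ i); rewrite mem_index_iota i2 => /(_ isT).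
  by rewrite mulf_eq0 invr_eq0 (gt_eqF (M0 i i2')) orbF => /eqP.
rewrite sqrtrM; last by rewrite divr_ge0 ?totvar_ge0// ltW.
rewrite sqrtrM ?ltW// sqrtrV ?totvar_ge0// !invfM invrK.
have a0 : Num.sqrt A != 0 by rewrite gt_eqF// sqrtr_gt0.
set b := (Num.sqrt B)^-1; set a := Num.sqrt A in a0 *; set s := Num.sqrt _; by field.
Qed.

(** Division by zero gives 0: all weights [wwhat] vanish, and so does the inverse square root. *)
Lemma asim_eq0 z z' : totvar z = 0 -> asim z z' = 0.
Proof.
move=> S0; rewrite /asim big1 ?mul0r ?sqrtr0 ?invr0// => i _.
by rewrite /wwhat -/(totvar z) S0 invr0 mulr0 mul0r.
Qed.

(** Rows start at 1: after normalization these are exactly the coordinates that enter the [colM],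
    while row 0 belongs to the plane of the shock. *)
Definition triangle_idx : set I :=
  [set lk | [/\ (1 <= lk.1)%N, (lk.1 <= n - lk.2)%N & (1 <= lk.2 <= n.-1)%N]].

Definition next_diagonal : set I :=
  [set lk | (2 <= lk.1 <= n)%N /\ lk.2 = (n - lk.1 + 1)%N].

Local Notation coord := (g_sigma_algebraType (@cylinders R I triangle_idx)).

(** The ratio of estimated to true variance, written in the normalized coordinates. *)
Definition simvar (v : coord) : R := \sum_(2 <= i < n.+1) ww i * colM v i.

Lemma triangle_idx_all : triangle_idx `<=` all_idx n.
Proof. by move=> lk [l1 l2 l3]; left; split => //; lia. Qed.

Lemma next_diagonal_all : next_diagonal `<=` all_idx n.
Proof. by move=> lk [l1 l2]; right; split => //; lia. Qed.

Lemma triangle_next_diagonal lk : triangle_idx lk -> ~ next_diagonal lk.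
Proof. by move=> [l1 l2 l3] [l4 l5]; lia. Qed.

Lemma measurable_colM i : (2 <= i <= n)%N ->
  measurable_fun setT (fun v : coord => colM v i).
Proof.
move=> i2; apply: measurable_funM => //; apply: measurable_sum_seq => l.
rewrite mem_index_iota => li; apply: measurable_funX; apply: measurable_coordinate.
by split => /=; lia.
Qed.

Lemma measurable_simvar : measurable_fun setT simvar.
Proof.
apply: measurable_sum_seq => i; rewrite mem_index_iota => i2.
by apply: measurable_funM => //; apply: measurable_colM; lia.
Qed.

Lemma colM_ge0 (v : I -> R) i : 0 <= colM v i.
Proof. by rewrite mulr_ge0 ?invr_ge0// sumr_ge0// => l _; exact: sqr_ge0. Qed.

Lemma simvar_gt0 (v : coord) : (forall i, (2 <= i <= n)%N -> 0 < colM v i) -> 0 < simvar v.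
Proof.
move=> M0; have ww_gt0 i : (2 <= i <= n)%N -> 0 < ww i.
  move=> i2; rewrite divr_gt0//; last exact: payvar_gt0.
  by rewrite mulr_gt0 ?exprn_gt0 ?sigma_gt0 ?(vv_gt0 gamma C_gt0 i2)//; lia.
rewrite /simvar big_ltn; last lia.
apply: ltr_wpDr; last by rewrite mulr_gt0 ?ww_gt0 ?M0//; lia.
rewrite big_nat sumr_ge0// => i i2.
by rewrite mulr_ge0 ?colM_ge0// ltW// ww_gt0//; lia.
Qed.

Section probability.
Context d e (T : measurableType d) (E : measurableType e) (P : probability T R).
Context (V0 : T -> E) (X : I -> T -> R).
Hypothesis indX : indep_normal P V0 (all_idx n) X.
Local Notation V := (coordinate_map triangle_idx X).

Lemma measurable_V : measurable_fun setT V.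
Proof.
apply: measurable_coordinate_map => i /triangle_idx_all.
by case: indX => _ mX _; exact: mX.
Qed.

(** [colM] can vanish only where its row 1 coordinate does, a null event since [gauss] has no atoms;
    row 1 occurs in the sum because i >= 2. *)
Lemma ae_colM_gt0 : {ae P, forall w, forall i, (2 <= i <= n)%N -> 0 < colM (V w) i}.
Proof.
have X0 i : {ae P, forall w, (2 <= i <= n)%N -> 0 < colM (V w) i}.
  have [i2|i2] := boolP (2 <= i <= n)%N; last by exact: aeW.
  have Ti : triangle_idx (1%N, (n - i + 1)%N) by split => /=; lia.
  have [_ mX indE] := indX.
  exists (X (1%N, (n - i + 1)%N) @^-1` [set 0]); split.
  - by apply: measurable_preimage => //; apply: mX; exact: triangle_idx_all.
  - have := indE setT [:: (1%N, (n - i + 1)%N)] (fun=> [set 0]) measurableT isT _ (fun=> _).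
    rewrite box_cons box_nil setIT preimage_setT setTI big_seq1 gauss_set1 mule0; apply => //.
    by move=> p; rewrite inE => /eqP->; exact: triangle_idx_all.
  move=> w /= /not_implyP[_ /negP]; rewrite -leNgt => M0; apply: contrapT => x0.
  move: M0; apply/negP; rewrite -ltNge mulr_gt0 ?invr_gt0 ?ltr0n//; first lia.
  rewrite big_ltn; last lia.
  apply: ltr_wpDr; first by rewrite sumr_ge0// => l _; exact: sqr_ge0.
  by rewrite lt_neqAle sqr_ge0 andbT eq_sym sqrf_eq0; apply/eqP.
have := ae_foralln X0; apply: filterS => w H i; exact: H.
Qed.

(** Applied twice: to the true error with the constants sigma, and to the model with the random
    [sigsim]. All shocks are rotated into the diagonal entry of accident year 2, which exists as n
    >= 2. *)
Lemma shock_combination (b : nat -> coord -> R) :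
  (forall i, (2 <= i <= n)%N -> measurable_fun setT (b i)) -> (forall i v, 0 <= b i v) ->
  exists U, indep_normal P V next_diagonal U /\ forall w,
    \sum_(2 <= i < n.+1) b i (V w) * (Num.sqrt (vv i) * X (i, n - i + 1)%N w) =
    Num.sqrt (\sum_(2 <= i < n.+1) b i (V w) ^+ 2 * vv i) * U (2, n - 2 + 1)%N w.
Proof.
move=> mb b0.
have indV := indep_normal_absorb indX triangle_idx_all next_diagonal_all triangle_next_diagonal.
pose a (p : I) v := if (2 <= p.1 <= n)%N then b p.1 v * Num.sqrt (vv p.1) else 0.
pose dg i := (i, n - i + 1)%N.
have rowE : [seq dg i | i <- index_iota 2 n.+1] = dg 2%N :: [seq dg i | i <- index_iota 3 n.+1].
  by rewrite /index_iota (_ : n.+1 - 2 = (n.+1 - 3).+1)%N//; lia.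
have sumE (F : I -> R) : \sum_(p <- dg 2%N :: [seq dg i | i <- index_iota 3 n.+1]) F p =
    \sum_(2 <= i < n.+1) F (dg i) by rewrite -rowE big_map.
have [||||U [indU _ sumU _]] := indep_normal_combine indV (j0 := dg 2%N)
    (l := [seq dg i | i <- index_iota 3 n.+1]) (a := a).
- by rewrite -rowE map_inj_uniq ?iota_uniq// => i j [].
- move=> p; rewrite -rowE => /mapP[i]; rewrite mem_index_iota => i2 ->.
  by split => //=; lia.
- move=> p; rewrite /a; have [p2|_] := boolP (2 <= p.1 <= n)%N; last exact: measurable_cst.
  by apply: measurable_funM => //; exact: mb.
- by move=> v; rewrite /a; case: ifP => // _; rewrite mulr_ge0 ?sqrtr_ge0.
exists U; split => // w; have := sumU w; rewrite !sumE => sE.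
rewrite (_ : \sum_(2 <= i < n.+1) b i (V w) ^+ 2 * vv i =
  \sum_(2 <= i < n.+1) a (dg i) (V w) ^+ 2); last first.
  apply: eq_big_nat => i i2; have i2' : (2 <= i <= n)%N by lia.
  by rewrite /a /= i2' exprMn sqr_sqrtr// ltW// vv_gt0.
rewrite -sE; apply: eq_big_nat => i i2; have i2' : (2 <= i <= n)%N by lia.
by rewrite /a /= i2' mulrA.
Qed.

Section studentized.
Variables (U : I -> T -> R) (j : I).
Hypotheses (indU : indep_normal P V next_diagonal U) (Dj : next_diagonal j).

Definition studentized w : R := U j w * (Num.sqrt (simvar (V w)))^-1.

Lemma measurable_invsd : measurable_fun setT (fun v : coord => (Num.sqrt (simvar v))^-1).
Proof.
apply: (measurableT_comp measurable_invr).
exact: (measurableT_comp measurable_sqrtr measurable_simvar).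
Qed.

Lemma measurable_studentized : measurable_fun setT studentized.
Proof.
have [mV mU _] := indU.
apply: measurable_funM; first exact: mU.
exact: (measurableT_comp measurable_invsd mV).
Qed.

Lemma ae_simvar_gt0 : {ae P, forall w, 0 < simvar (V w)}.
Proof. by have := ae_colM_gt0; apply: filterS => w; exact: simvar_gt0. Qed.

(** Once the triangle coordinates are fixed, the statistic equals [x] for one value of the normal
    only. *)
Lemma studentized_atomless x : P [set w | studentized w = x] = 0%E.
Proof.
(* Positivity of [simvar] is built in: where it fails the inverse square root is 0, and for x = 0
   the section would be the whole line. *)
pose W : set (coord * R)%type :=
  [set p | 0 < simvar p.1] `&` [set p | p.2 * (Num.sqrt (simvar p.1))^-1 = x].
have mW : measurable W.
  apply: measurableI.
    have -> : [set p : coord * R | 0 < simvar p.1] = (simvar \o fst) @^-1` `]0, +oo[.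
      by apply/seteqP; split => p /=; rewrite in_itv/= andbT.
    apply: measurable_preimage; last exact: measurable_itv.
    exact: (measurableT_comp measurable_simvar measurable_fst).
  apply: (measurable_preimage _ _ _ _
    (fun p : coord * R => p.2 * (Num.sqrt (simvar p.1))^-1) [set x]) => //.
  apply: measurable_funM => //.
  exact: (measurableT_comp measurable_invsd measurable_fst).
have mVU : measurable_fun setT (fun w => (V w, U j w)).
  by have [mV mU _] := indU; apply: measurable_fun_pair => //; exact: mU.
rewrite -(indep_normal_pair_null indU Dj mW).
  apply: ae_measure_eq.
  - exact: (measurable_preimage _ _ _ _ studentized [set x] measurable_studentized).
  - exact: (measurable_preimage _ _ _ _ _ _ mVU mW).
  - by have := ae_simvar_gt0; apply: filterS => w S0; split => [|[]].
move=> v; have [v0|v0] := ltP 0 (simvar v).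
  rewrite -(gauss_set1 (x * Num.sqrt (simvar v))); congr (_ _).
  have s0 : Num.sqrt (simvar v) != 0 by rewrite gt_eqF// sqrtr_gt0.
  apply/seteqP; split => y; rewrite /xsection/= inE.
    by move=> [_ /= <-]; rewrite mulfVK.
  by move=> ->; split => //=; rewrite mulfK.
rewrite (_ : xsection W v = set0) ?measure0//.
by rewrite -subset0 => y; rewrite /xsection/= inE => -[/=]; rewrite ltNge v0.
Qed.

End studentized.
End probability.

End model.

(** * The predictive quantile in closed form, and the coverage probability *)

Theorem theorem4p3 (R : realType) (n gamma : nat) (alpha : R)
    (C : nat -> nat -> R) (f sigma : nat -> R)
    (d : measure_display) (T : measurableType d) (P : probability T R)
    (zeta : nat * nat -> T -> R)
    (d' : measure_display) (T' : measurableType d') (P' : probability T' R)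
    (zeta' : nat * nat -> T' -> R) :
  (2 <= n)%N ->
  (gamma = 0 \/ gamma = 1)%N ->
  0 < alpha < 1 ->
  (forall i k, (i + k <= n)%N -> 0 < C i k) ->
  (forall k, (1 <= k <= n.-1)%N -> 0 < f k) ->
  (forall k, (1 <= k <= n.-1)%N -> 0 < sigma k) ->
  f n = 1 -> sigma n = 0 ->
  iid_std_normal P (all_idx n) zeta ->
  iid_std_normal P' (all_idx n) zeta' ->
  P [set w | Ztrue n gamma C f sigma (fun ik => zeta ik w) <=
             quantile P'
               (fun w' => Zadj n gamma C f sigma (fun ik => zeta ik w)
                               (fun ik => zeta' ik w')) alpha]
  = alpha%:E.
Proof.
move=> n2 _ a01 C0 _ sg0 fn1 sgn0 iidz iidz'.
have [X [indX nX]] := normalize_triangle gamma C0 (indep_normal_iid iidz).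
have [X' [indX' nX']] := normalize_triangle gamma C0 (indep_normal_iid iidz').
pose V := coordinate_map (triangle_idx n) X.
pose V' := coordinate_map (triangle_idx n) X'.
pose c i := (n - i + 1)%N.
pose z w ik := zeta ik w; pose z' w ik := zeta' ik w.
have ME w i : (2 <= i <= n)%N -> Mp n gamma C (z w) (c i) = colM n (V w) i.
  by move=> i2; have [_] := nX i i2 w.
have ME' w i : (2 <= i <= n)%N -> Mp n gamma C (z' w) (c i) = colM n (V' w) i.
  by move=> i2; have [_] := nX' i i2 w.
have j0D : next_diagonal n (2%N, n - 2 + 1)%N by split => //=; lia.
have sE w : \sum_(2 <= i < n.+1) ww n gamma C sigma i * Mp n gamma C (z w) (n - i + 1) =
    simvar gamma C sigma (V w).
  by apply: eq_big_nat => i i2; rewrite ME//; lia.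
have sE' w : \sum_(2 <= i < n.+1) ww n gamma C sigma i * Mp n gamma C (z' w) (n - i + 1) =
    simvar gamma C sigma (V' w).
  by apply: eq_big_nat => i i2; rewrite ME'//; lia.
pose b (i : nat) (_ : g_sigma_algebraType (@cylinders R (nat * nat)%type (triangle_idx n))) :=
  if (2 <= i <= n)%N then sigma (c i) else 0.
have [||U [indU sumU]] := shock_combination gamma n2 C0 indX (b := b).
- by move=> i _; exact: measurable_cst.
- by move=> i v; rewrite /b; case: ifP => // i2; apply/ltW/sg0; rewrite /c; lia.
pose j0 := (2%N, n - 2 + 1)%N.
have mU : measurable_fun setT (U j0) by have [_ mU _] := indU; exact: mU.
have mV : measurable_fun setT V by exact: (measurable_V indX).
have mV' : measurable_fun setT V' by exact: (measurable_V indX').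
pose Y := studentized n gamma C sigma X U j0.
have mY : measurable_fun setT Y by exact: (measurable_studentized gamma C sigma n2 indU j0D).
have Y0 x : P [set w | Y w = x] = 0%E.
  exact: (studentized_atomless gamma n2 C0 sg0 indX indU j0D).
pose q := quantile P Y alpha.
pose m (zz : nat * nat -> R) := \sum_(1 <= i < n.+1) Zhat n gamma C f sigma zz i.
(* Proved for every realization [zz], not just almost every one: the quantile depends on [zz]
   through location and scale only. *)
have quantileE zz : quantile P' (fun w' => Zadj n gamma C f sigma zz (z' w')) alpha =
    m zz + Num.sqrt (totvar n gamma C f sigma zz) * q.
  have [S0|S0] := eqVneq (totvar n gamma C f sigma zz) 0.
    rewrite (_ : (fun w' => _) = (fun=> m zz)); last first.
      by apply/funext => w'; rewrite Zadj_decomp// asim_eq0// mul0r addr0.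
    by rewrite quantile_cst// S0 sqrtr0 mul0r addr0.
  have Sp : 0 < totvar n gamma C f sigma zz by rewrite lt_neqAle eq_sym S0 totvar_ge0.
  have s0 : 0 < Num.sqrt (totvar n gamma C f sigma zz) by rewrite sqrtr_gt0.
  rewrite -(quantile_affine P (m zz) mY a01 s0).
  set s := Num.sqrt _ in s0 *.
  (* A quantile depends on the distribution function alone, so variables on different spaces may be
     compared. *)
  suff cdfE x : P' [set w' | Zadj n gamma C f sigma zz (z' w') <= x] =
      P [set w | m zz + s * Y w <= x].
    by rewrite /quantile; congr inf; apply/seteqP; split => x /=; rewrite cdfE.
  pose b' i (v : g_sigma_algebraType (@cylinders R (nat * nat)%type (triangle_idx n))) :=
    if (2 <= i <= n)%N then
      Num.sqrt (sigmahat2 n gamma C f sigma zz (c i) / colM n v i) else 0.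
  have mb' i : (2 <= i <= n)%N -> measurable_fun setT (b' i).
    move=> i2; rewrite /b' i2; apply: (measurableT_comp measurable_sqrtr).
    apply: measurable_funM => //.
    by apply: (measurableT_comp measurable_invr); exact: measurable_colM.
  have [|U' [indU' sumU']] := shock_combination gamma n2 C0 indX' mb'.
    by move=> i v; rewrite /b'; case: ifP => // _; exact: sqrtr_ge0.
  have mU' : measurable_fun setT (U' j0) by have [_ mU' _] := indU'; exact: mU'.
  pose sd v := Num.sqrt (\sum_(2 <= i < n.+1) b' i v ^+ 2 * vv n gamma C i).
  pose asimV (v : g_sigma_algebraType (@cylinders R (nat * nat)%type (triangle_idx n))) :=
    (Num.sqrt ((\sum_(2 <= i < n.+1) wwhat n gamma C f sigma zz i / colM n v i) *
      simvar gamma C sigma v))^-1.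
  have sigsimE w' i : (2 <= i <= n)%N -> sigsim n gamma C f sigma zz (z' w') (c i) = b' i (V' w').
    by move=> i2; rewrite /sigsim ifF ?ME' /b' ?i2//; apply/eqP; rewrite /c; lia.
  have asimE w' : asim n gamma C f sigma zz (z' w') = asimV (V' w').
    rewrite /asim sE'; congr (Num.sqrt (_ * _))^-1.
    by apply: eq_big_nat => i i2; rewrite ME'//; lia.
  have ZadjE w' : Zadj n gamma C f sigma zz (z' w') =
      m zz + asimV (V' w') * (sd (V' w') * U' j0 w').
    rewrite Zadj_decomp// asimE -sumU'; congr (_ + _ * _).
    apply: eq_big_nat => i i2; have i2' : (2 <= i <= n)%N by lia.
    by rewrite sigsimE//; have [-> _] := nX' i i2' w'.
  have sdE w' : sd (V' w') = Num.sqrt (\sum_(2 <= i < n.+1)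
      sigsim n gamma C f sigma zz (z' w') (n - i + 1)%N ^+ 2 * vv n gamma C i).
    by congr Num.sqrt; apply: eq_big_nat => i i2; rewrite sigsimE//; lia.
  have msd : measurable_fun setT sd.
    apply: (measurableT_comp measurable_sqrtr); apply: measurable_sum_seq => i.
    rewrite mem_index_iota => i2; apply: measurable_funM => //.
    by apply: measurable_funX; apply: mb'; lia.
  have masimV : measurable_fun setT asimV.
    apply: (measurableT_comp measurable_invr); apply: (measurableT_comp measurable_sqrtr).
    apply: measurable_funM; last exact: measurable_simvar.
    apply: measurable_sum_seq => i; rewrite mem_index_iota => i2.
    apply: measurable_funM => //; apply: (measurableT_comp measurable_invr).
    by apply: measurable_colM; lia.
  pose Y' := studentized n gamma C sigma X' U' j0.
  have mY' : measurable_fun setT Y'.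
    exact: (measurable_studentized gamma C sigma n2 indU' j0D).
  (* Where all simulated [Mp] are positive, hence almost surely, [asim_sqrt] turns the model
     deviation into s times the studentized variable of the simulated space. *)
  transitivity (P' [set w' | m zz + s * Y' w' <= x]).
    apply: ae_measure_eq.
    - under eq_set do rewrite ZadjE.
      apply: measurable_le_set; apply: measurable_funD => //; apply: measurable_funM.
        exact: (measurableT_comp masimV mV').
      by apply: measurable_funM => //; exact: (measurableT_comp msd mV').
    - apply: measurable_le_set; apply: measurable_funD => //; exact: measurable_funM.
    have := ae_colM_gt0 n2 indX'; apply: filterS => w' M0 /=.
    rewrite ZadjE sdE mulrA -asimE asim_sqrt//; last first.
      by move=> i i2; rewrite ME'//; exact: M0.
    by rewrite sE' -mulrA [X in s * X]mulrC.
  pose W : set (g_sigma_algebraType (@cylinders R (nat * nat)%type (triangle_idx n)) * R)%type :=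
    [set p | m zz + s * (p.2 * (Num.sqrt (simvar gamma C sigma p.1))^-1) <= x].
  apply: (indep_normal_pair_law (W := W) indU' indU j0D).
    by move=> A mA; exact: (coordinate_map_law indX' indX (@triangle_idx_all n) mA).
  apply: measurable_le_set; apply: measurable_funD => //; apply: measurable_funM => //.
  apply: measurable_funM => //.
  exact: (measurableT_comp (measurable_invsd gamma C sigma n2) measurable_fst).
under eq_set do rewrite quantileE.
rewrite -(quantile_prob mY a01 Y0).
have pv0 : 0 < payvar n gamma C sigma by exact: payvar_gt0.
have ZtrueE w : Ztrue n gamma C f sigma (z w) =
    m (z w) + Num.sqrt (payvar n gamma C sigma) * U j0 w.
  rewrite Ztrue_decomp//; congr (_ + _).
  have -> : payvar n gamma C sigma = \sum_(2 <= i < n.+1) b i (V w) ^+ 2 * vv n gamma C i.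
    by apply: eq_big_nat => i i2; rewrite /b ifT//; lia.
  rewrite -sumU; apply: eq_big_nat => i i2; have i2' : (2 <= i <= n)%N by lia.
  by rewrite /b i2'; have [-> _] := nX i i2' w.
have totE w : totvar n gamma C f sigma (z w) =
    payvar n gamma C sigma * simvar gamma C sigma (V w) by rewrite totvarE// sE.
(* The forecast cancels on both sides, and so does sqrt([payvar]) > 0; this equality of events is
   exact and shows that the event is measurable. *)
have -> : [set w | Ztrue n gamma C f sigma (z w) <=
      m (z w) + Num.sqrt (totvar n gamma C f sigma (z w)) * q] =
    [set w | U j0 w - Num.sqrt (simvar gamma C sigma (V w)) * q <= 0].
  apply/seteqP; split => w /=; rewrite ZtrueE totE lerD2l sqrtrM ?(ltW pv0)// -mulrA;
    by rewrite ler_pM2l ?sqrtr_gt0// subr_le0.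
apply: ae_measure_eq.
- apply: measurable_le_set; apply: measurable_funB => //; apply: measurable_funM => //.
  apply: (measurableT_comp measurable_sqrtr).
  exact: (measurableT_comp (measurable_simvar gamma C sigma n2) mV).
- exact: measurable_le_set.
(* Dividing by sqrt([simvar]) is legitimate only where it is positive, hence an almost sure
   equivalence. *)
have := ae_colM_gt0 n2 indX; apply: filterS => w M0 /=.
have S0 := simvar_gt0 gamma n2 C0 sg0 M0.
by rewrite subr_le0 /Y /studentized ler_pdivrMr ?sqrtr_gt0// mulrC.
Qed.
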